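(* Let $\mathcal{M}=(\mathcal{S},\mathcal{A},\boldsymbol{P},\boldsymbol{r},\gamma)$ be a discounted Markov decision process (DMDP) with a generative model, and suppose that a state can be sampled from each probability vector $\boldsymbol{P}_{s,a}$ within time $O(1)$. Then for any $\epsilon,\delta\in(0,1)$ there exists an algorithm that halts in time $$T:=O\left[\frac{|\mathcal{S}||\mathcal{A}|}{(1-\gamma)^3\epsilon^2}\log\left(\frac{|\mathcal{S}||\mathcal{A}|}{(1-\gamma)\delta\epsilon}\right)\log\left(\frac{1}{(1-\gamma)\epsilon}\right)\right]$$ and obtains a policy $\pi$ such that $\boldsymbol{v}^*-\epsilon\boldsymbol{1}\le \boldsymbol{v}^{\pi}\le \boldsymbol{v}^*$ with probability at least $1-\delta$, where $\boldsymbol{v}^*$ is the optimal value of $\mathcal{M}$. The algorithm uses space $O(|\mathcal{S}||\mathcal{A}|)$ and queries the generative model for at most $O(T)$ fresh samples.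
   Context: A DMDP is a tuple $(\mathcal{S},\mathcal{A},\boldsymbol{P},\boldsymbol{r},\gamma)$ with finite state space $\mathcal{S}$, finite action space $\mathcal{A}$, transition matrix $\boldsymbol{P}\in\mathbb{R}^{\mathcal{S}\times\mathcal{A}\times\mathcal{S}}$ (each $\boldsymbol{P}_{s,a}$ is a probability vector over $\mathcal{S}$; $\boldsymbol{P}_{s,a}(s')$ is the probability of moving to $s'$ from $s$ under action $a$), rewards $\boldsymbol{r}\in[0,1]^{\mathcal{S}\times\mathcal{A}}$ and discount factor $\gamma\in(0,1)$. The states, actions, rewards and $\gamma$ are known; $\boldsymbol{P}$ is unknown and is accessed only through a generative model (sampling oracle): given any $(s,a)$, it returns an independent sample of a state from the distribution $\boldsymbol{P}_{s,a}$, in $O(1)$ time per query. A policy is a map $\pi:\mathcal{S}\to\mathcal{A}$. For $\boldsymbol{u}\in\mathbb{R}^{\mathcal{S}}$, define $\mathcal{T}(\boldsymbol{u})_s=\max_{a\in\mathcal{A}}[\boldsymbol{r}_{s,a}+\gamma\boldsymbol{P}_{s,a}^\top\boldsymbol{u}]$ and $\mathcal{T}_\pi(\boldsymbol{u})_s=\boldsymbol{r}_{s,\pi(s)}+\gamma\boldsymbol{P}_{s,\pi(s)}^\top\boldsymbol{u}$. The optimal value $\boldsymbol{v}^*$ is the unique vector with $\mathcal{T}(\boldsymbol{v}^* )=\boldsymbol{v}^*$, and $\boldsymbol{v}^\pi$ is the unique vector with $\mathcal{T}_\pi(\boldsymbol{v}^\pi)=\boldsymbol{v}^\pi$. Vector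 inequalities are coordinatewise and $\boldsymbol{1}$ is the all-ones vector. Space is measured in words of memory.
   Formalization: Each of the two logarithms in T is replaced by its maximum with 1, because as (1-γ)ε tends to 1 the factor log(1/((1-γ)ε)) tends to 0 and the literal bound would fall below one operation. *)

(* Defs.v *)
From HB Require Import structures.
From mathcomp Require Export all_boot all_order all_algebra.
From mathcomp Require Export all_classical all_reals exp.

Set Implicit Arguments.
Unset Strict Implicit.
Unset Printing Implicit Defensive.

Import Order.TTheory GRing.Theory Num.Theory.
Local Open Scope ring_scope.

(** * Discounted Markov decision processes *)

Record dmdp (R : realType) (S A : finType) := Dmdp {
  trans : S -> A -> S -> R;
  reward : S -> A -> R;
  discount : R;
  trans_ge0 : forall s a s', 0 <= trans s a s';
  trans_sum1 : forall s a, \sum_(s' : S) trans s a s' = 1;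
  reward_itv : forall s a, 0 <= reward s a <= 1;
  discount_itv : 0 < discount < 1 }.

Section Values.
Context (R : realType) (S A : finType) (M : dmdp R S A).

Definition backup (u : {ffun S -> R}) (s : S) (a : A) : R :=
  reward M s a + discount M * \sum_(s' : S) trans M s a s' * u s'.

(* The supremum is over a finite set of reals, so it is a maximum as soon as
   there is an action. A [\big[Num.max/0]] would be wrong for negative [u]. *)
Definition bellman (u : {ffun S -> R}) : {ffun S -> R} :=
  [ffun s => sup [set backup u s a | a in [set: A]]%classic].

Definition bellman_policy (pi : S -> A) (u : {ffun S -> R}) : {ffun S -> R} :=
  [ffun s => backup u s (pi s)].

(* Both operators are [discount M]-contractions, hence have exactly one fixed
   point (for [bellman], when there is an action): the default value 0 given
   to [xget] plays no role. *)
Definition optimal_value : {ffun S -> R} :=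
  xget 0 [set v | bellman v = v]%classic.

Definition policy_value (pi : S -> A) : {ffun S -> R} :=
  xget 0 [set v | bellman_policy pi v = v]%classic.

End Values.

(** * Programs

    A real-number random access machine with a sampling oracle. The memory
    consists of arrays of integer words and arrays of real words, both kinds of
    arrays being named by the natural numbers that occur in the program text;
    a scalar variable is cell 0 of an array. A program does not mention the
    decision process: it sees it only through its input and through [Sample].

    The only integer operation is the successor, and it is charged for, so that
    integer words have O(log(input + time)) bits: arithmetic cannot be used to
    pack many words in one. There is likewise no rounding from reals to
    integers, and the only real literals are natural numbers. *)

Inductive iexp : Type :=
| IConst of nat
| ICell of nat & iexp
| ISucc of iexp.

Inductive rexp : Type :=
| RConst of nat
| RCell of nat & iexp
| RAdd of rexp & rexp
| RSub of rexp & rexp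
| RMul of rexp & rexp
| RDiv of rexp & rexp
| RSqrt of rexp.

Inductive bexp : Type :=
| BILt of iexp & iexp
| BRLt of rexp & rexp
| BNot of bexp
| BAnd of bexp & bexp.

(* [IAssign x i e] is [x[i] := e] on integer arrays, [RAssign] the same on real
   arrays, and [Sample x i s a] stores in cell [i] of integer array [x] the
   index of a state drawn from [trans M s a]. *)
Inductive cmd : Type :=
| Skip
| IAssign of nat & iexp & iexp
| RAssign of nat & iexp & rexp
| Sample of nat & iexp & iexp & iexp
| Seq of cmd & cmd
| If of bexp & cmd & cmd
| While of bexp & cmd.

Fixpoint icost (e : iexp) : nat :=
  match e with
  | IConst _ => 1
  | ICell _ i => (icost i).+1
  | ISucc e1 => (icost e1).+1
  end.

Fixpoint rcost (e : rexp) : nat :=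
  match e with
  | RConst _ => 1
  | RCell _ i => (icost i).+1
  | RAdd e1 e2 | RSub e1 e2 | RMul e1 e2 | RDiv e1 e2 => (rcost e1 + rcost e2).+1
  | RSqrt e1 => (rcost e1).+1
  end.

Fixpoint bcost (b : bexp) : nat :=
  match b with
  | BILt e1 e2 => (icost e1 + icost e2).+1
  | BRLt e1 e2 => (rcost e1 + rcost e2).+1
  | BNot b1 => (bcost b1).+1
  | BAnd b1 b2 => (bcost b1 + bcost b2).+1
  end.

(** * Execution *)

Definition update (T : Type) (m : nat -> nat -> T) (x i : nat) (v : T) :
    nat -> nat -> T :=
  fun y j => if (y == x) && (j == i) then v else m y j.

Definition decode (T : finType) (i : nat) : option T := onth (enum T) i.

(* [cont] is the list of commands that remain to be executed. Its length is at
   most one plus the nesting depth of the program, a constant, so it is not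
   charged as space. *)
Record config (R : realType) := Config {
  cont : seq cmd;
  imem : nat -> nat -> nat;
  rmem : nat -> nat -> R;
  clock : nat;
  queries : nat }.

Inductive move (R : realType) (S A : finType) : Type :=
| Stuck
| Goto of config R
| Query of S & A & (S -> config R).
Arguments Stuck {R S A}.
Arguments Goto {R S A}.

Section Machine.
(* The machine has [narr] integer arrays and [narr] real arrays of [len] cells
   each. Access to any other cell is a fault. *)
Context (R : realType) (narr len : nat).

Definition words : nat := (narr * len + narr * len)%N.

Definition allocated (x i : nat) : bool := (x < narr)%N && (i < len)%N.

Section Eval.
Context (c : config R).

Fixpoint ieval (e : iexp) : option nat :=
  match e with
  | IConst n => Some n
  | ICell x i =>
      obind (fun i' => if allocated x i' then Some (imem c x i') else None)
            (ieval i)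
  | ISucc e1 => omap succn (ieval e1)
  end.

Definition obind2 (T U V : Type) (f : T -> U -> V) (x : option T) (y : option U)
    : option V :=
  obind (fun x' => omap (f x') y) x.

Fixpoint reval (e : rexp) : option R :=
  match e with
  | RConst n => Some n%:R
  | RCell x i =>
      obind (fun i' => if allocated x i' then Some (rmem c x i') else None)
            (ieval i)
  | RAdd e1 e2 => obind2 (fun a b => a + b) (reval e1) (reval e2)
  | RSub e1 e2 => obind2 (fun a b => a - b) (reval e1) (reval e2)
  | RMul e1 e2 => obind2 (fun a b => a * b) (reval e1) (reval e2)
  | RDiv e1 e2 => obind2 (fun a b => a / b) (reval e1) (reval e2)
  | RSqrt e1 => omap Num.sqrt (reval e1)
  end.

Fixpoint beval (b : bexp) : option bool :=
  match b with
  | BILt e1 e2 => obind2 (fun m n => (m < n)%N) (ieval e1) (ieval e2)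
  | BRLt e1 e2 => obind2 (fun a b => a < b) (reval e1) (reval e2)
  | BNot b1 => omap negb (beval b1)
  | BAnd b1 b2 => obind2 andb (beval b1) (beval b2)
  end.

End Eval.

Context (S A : finType).

(* [tau] is the time taken by one call to the sampling oracle. A configuration
   is stuck when its program is finished or when it faults; the two are told
   apart by [halted]. *)
Definition step (tau : nat) (c : config R) : move R S A :=
  let: Config k im rm t q := c in
  match k with
  | [::] => Stuck
  | Skip :: k' => Goto (Config k' im rm t.+1 q)
  | IAssign x i e :: k' =>
      match ieval c i, ieval c e with
      | Some i', Some v =>
          if allocated x i' then
            Goto (Config k' (update im x i' v) rm (t + (icost i + icost e).+1) q)
          else Stuck
      | _, _ => Stuck
      end
  | RAssign x i e :: k' =>
      match ieval c i, reval c e with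
      | Some i', Some v =>
          if allocated x i' then
            Goto (Config k' im (update rm x i' v) (t + (icost i + rcost e).+1) q)
          else Stuck
      | _, _ => Stuck
      end
  | Sample x i es ea :: k' =>
      match ieval c i, obind (decode S) (ieval c es),
            obind (decode A) (ieval c ea) with
      | Some i', Some s, Some a =>
          if allocated x i' then
            Query s a (fun s' =>
              Config k' (update im x i' (enum_rank s')) rm
                (t + (icost i + icost es + icost ea + tau).+1) q.+1)
          else Stuck
      | _, _, _ => Stuck
      end
  | Seq c1 c2 :: k' => Goto (Config [:: c1, c2 & k'] im rm t.+1 q)
  | If b c1 c2 :: k' =>
      match beval c b with
      | Some v =>
          Goto (Config ((if v then c1 else c2) :: k') im rm (t + (bcost b).+1) q)
      | None => Stuck
      end
  | While b c1 :: k' =>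
      match beval c b with
      | Some v =>
          Goto (Config (if v then [:: c1, While b c1 & k'] else k') im rm
                       (t + (bcost b).+1) q)
      | None => Stuck
      end
  end.

(* [Pr M tau n E c] is the probability that the configuration reached from [c]
   after [n] steps (or earlier, if it is stuck by then) satisfies [E]. Each
   query is answered by a fresh sample, independent of the past. *)
Fixpoint Pr (M : dmdp R S A) (tau n : nat) (E : config R -> Prop) (c : config R)
    : R :=
  if n is n'.+1 then
    match step tau c with
    | Stuck => (`[< E c >])%:R
    | Goto c' => Pr M tau n' E c'
    | Query s a f => \sum_(s' : S) trans M s a s' * Pr M tau n' E (f s')
    end
  else (`[< E c >])%:R.

Definition halted (c : config R) : Prop := cont c = [::].

(* The output is integer array 2. *)
Definition outputs (c : config R) (pi : S -> A) : Prop :=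
  halted c /\
  forall s : S, ieval c (ICell 2 (IConst (enum_rank s))) =
                Some (enum_rank (pi s) : nat).

End Machine.

(* The number of states and the number of actions are in integer arrays 0 and 1,
   the rewards (row by row), the discount factor, [eps] and [delta] in real
   arrays 0 to 3. The transition probabilities are not part of the input. *)
Definition initial (R : realType) (S A : finType) (M : dmdp R S A)
    (eps delta : R) (prog : cmd) : config R :=
  {| cont := [:: prog];
     imem := fun x i =>
       if i != 0 then 0%N else
       match x with 0 => #|S| | 1 => #|A| | _ => 0%N end;
     rmem := fun x i =>
       match x, i with
       | 0, _ =>
           match decode S (i %/ #|A|)%N, decode A (i %% #|A|)%N with
           | Some s, Some a => reward M s a
           | _, _ => 0
           end
       | 1, 0 => discount M
       | 2, 0 => eps
       | 3, 0 => delta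
       | _, _ => 0
       end;
     clock := 0;
     queries := 0 |}.

(* Each logarithm is truncated below at 1. This is how O(.) must be understood
   when [(1 - discount M) * eps] is close to 1: the product would otherwise
   tend to 0 there, and could not bound the running time of any program. *)
Definition time_bound (R : realType) (S A : finType) (M : dmdp R S A)
    (eps delta : R) : R :=
  let SA : R := (#|S| * #|A|)%:R in
  let g := 1 - discount M in
  SA / (g ^+ 3 * eps ^+ 2)
  * Num.max 1 (ln (SA / (g * delta * eps)))
  * Num.max 1 (ln (1 / (g * eps))).

(* Main.v *)
(* Variance-reduced value iteration with one-sided errors. The program keeps a
   value [v] and a policy [pi] such that [v <= T_pi v], hence
   [v <= v^pi <= v*], and updates them only with estimates that are below the
   true backup. An epoch halves the bound [u] on [v* - v], starting from
   [1 / (1 - gamma)]: it estimates [P v0] once, accurately, for the value [v0]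
   at its start, and then makes [O(1 / (1 - gamma))] sweeps in which only
   [P (v - v0)], of range [u], is estimated afresh.

   The mean of [y] over the next state [t] is estimated by averaging
   [y t - k (y t - y s) ^ 2] instead of [y t]. This lowers it by
   [k E (y t - y s) ^ 2], which makes the exponential moment of the error at
   most 1 at scale [k / 8] (Bernstein's inequality without an empirical
   variance or square roots). For [y = v*] the lowering is harmless, since the
   discounted sum of [E (v* t - v* s) ^ 2] along the optimal policy telescopes
   to [O(1 / (1 - gamma) ^ 2)]: with [k] of order [(1 - gamma) ^ 2 eps], sample
   sizes of order [L / ((1 - gamma) ^ 3 eps ^ 2)] suffice, where [exp (- L)] is
   the failure probability of one estimate. *)
Require Import Defs.
From mathcomp Require Import sequences ring lra zify.
Import Order.TTheory GRing.Theory Num.Theory.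
Local Open Scope ring_scope.

Set Implicit Arguments.
Unset Strict Implicit.
Unset Printing Implicit Defensive.

(** * A program logic with time and failure budgets *)

(** Whether an estimate is reliable depends on earlier ones: the range [u] of [v - v0] is known only
    if all previous estimates were good. Failures are therefore handled conditionally on the past. A
    budget [r], which bounds the expected final loss, is carried along the execution; each sample
    may redistribute it provided that its mean does not grow. A path on which an estimate fails
    holds at least the full loss [lam], and nothing more has to be shown about its values. Loop
    lengths and array accesses are controlled on all paths, so that one proof gives the running time
    with [lam = 0] and the error probability with [lam = 1]. The lowering is centred at [y s]
    because [y s] is known while the samples are read one by one, and the second moment about any
    point dominates the variance. In the sweeps, a scale of order [(1 - gamma) / u] and a margin of
    order [(1 - gamma) u] give samples of size [L / (1 - gamma) ^ 2] up to a constant, whatever [u]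
    is. *)

Fixpoint ival (im : nat -> nat -> nat) (e : iexp) : nat :=
  match e with
  | IConst n => n
  | ICell x i => im x (ival im i)
  | ISucc e1 => (ival im e1).+1
  end.

Section Values.
Context (R : realType).
Variables (im : nat -> nat -> nat) (rm : nat -> nat -> R).

Fixpoint rval (e : rexp) : R :=
  match e with
  | RConst n => n%:R
  | RCell x i => rm x (ival im i)
  | RAdd e1 e2 => rval e1 + rval e2
  | RSub e1 e2 => rval e1 - rval e2
  | RMul e1 e2 => rval e1 * rval e2
  | RDiv e1 e2 => rval e1 / rval e2
  | RSqrt e1 => Num.sqrt (rval e1)
  end.

Fixpoint bval (b : bexp) : bool :=
  match b with
  | BILt e1 e2 => (ival im e1 < ival im e2)%N
  | BRLt e1 e2 => rval e1 < rval e2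
  | BNot b1 => ~~ bval b1
  | BAnd b1 b2 => bval b1 && bval b2
  end.

End Values.

Section Safety.
Variables (narr len : nat) (im : nat -> nat -> nat).

Fixpoint isafe (e : iexp) : Prop :=
  match e with
  | IConst _ => True
  | ICell x i => isafe i /\ allocated narr len x (ival im i)
  | ISucc e1 => isafe e1
  end.

Fixpoint rsafe (e : rexp) : Prop :=
  match e with
  | RConst _ => True
  | RCell x i => isafe i /\ allocated narr len x (ival im i)
  | RAdd e1 e2 | RSub e1 e2 | RMul e1 e2 | RDiv e1 e2 => rsafe e1 /\ rsafe e2
  | RSqrt e1 => rsafe e1
  end.

Fixpoint bsafe (b : bexp) : Prop :=
  match b with
  | BILt e1 e2 => isafe e1 /\ isafe e2
  | BRLt e1 e2 => rsafe e1 /\ rsafe e2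
  | BNot b1 => bsafe b1
  | BAnd b1 b2 => bsafe b1 /\ bsafe b2
  end.

Lemma ievalE (R : realType) (c : config R) e :
  imem c = im -> isafe e -> ieval narr len c e = Some (ival im e).
Proof.
move=> cim; elim: e => //= [x i IH [/IH -> /= ->]|e IH /IH ->] //.
by rewrite cim.
Qed.

Lemma revalE (R : realType) (c : config R) e :
  imem c = im -> rsafe e -> reval narr len c e = Some (rval im (rmem c) e).
Proof.
move=> cim; elim: e => //=; try by move=> e1 IH1 e2 IH2 [/IH1 -> /IH2 ->].
  by move=> x i [/(ievalE cim) -> /= ->].
by move=> e IH /IH ->.
Qed.

Lemma bevalE (R : realType) (c : config R) b :
  imem c = im -> bsafe b -> beval narr len c b = Some (bval im (rmem c) b).
Proof.
move=> cim; elim: b => //=.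
- by move=> e1 e2 [/(ievalE cim) -> /(ievalE cim) ->].
- by move=> e1 e2 [/(revalE cim) -> /(revalE cim) ->].
- by move=> b IH /IH ->.
- by move=> b1 IH1 b2 IH2 [/IH1 -> /IH2 ->].
Qed.

End Safety.

Lemma decode_rank (T : finType) (x : T) : decode T (enum_rank x) = Some x.
Proof.
by rewrite /decode onthE (nth_map x) ?nth_enum_rank // -cardE.
Qed.

Section Logic.
Context (R : realType) (S A : finType) (M : dmdp R S A) (narr len tau : nat).

Fixpoint expected (n : nat) (F : config R -> R) (c : config R) : R :=
  if n is n'.+1 then
    match step narr len S A tau c with
    | Stuck => F c
    | Goto c' => expected n' F c'
    | Query s a f => \sum_(s' : S) trans M s a s' * expected n' F (f s')
    end
  else F c.

Lemma PrE n E c : Pr narr len M tau n E c = 1 - expected n (fun c => (~~ `[< E c >])%:R) c.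
Proof.
have h (b : bool) : b%:R = 1 - (~~ b)%:R :> R by case: b; rewrite ?subr0 ?subrr.
elim: n c => [|n IH] c /=; first exact: h.
case: step => [|c'|s a f] //.
under eq_bigr do rewrite IH mulrBr mulr1.
by rewrite sumrB trans_sum1.
Qed.

Lemma expected_ge0 n F c : (forall c', 0 <= F c') -> 0 <= expected n F c.
Proof.
move=> F0; elim: n c => [|n IH] c //=.
case: step => [|c'|s a f] //.
by apply: sumr_ge0 => s' _; rewrite mulr_ge0 ?trans_ge0.
Qed.

(** The bound is required for all large step counts, so that the branches of a query, and later two
    different losses, can share one count. *)
Definition good (F : config R -> R) (c : config R) (r : R) : Prop :=
  exists n0, forall n, (n0 <= n)%N -> expected n F c <= r.

Lemma good_halt F c r : cont c = [::] -> F c <= r -> good F c r.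
Proof.
by move=> c0 Fr; exists 0%N => -[|n] _ //=; rewrite /step;
  case: c c0 Fr => k im rm t q /= ->.
Qed.

Lemma good_goto F c c' r : step narr len S A tau c = Goto c' -> good F c' r -> good F c r.
Proof. by move=> cc' [n0 h]; exists n0.+1 => -[//|n] /h; rewrite /= cc'. Qed.

Lemma good_query F c s a f (rs : S -> R) r :
  step narr len S A tau c = Query s a f -> \sum_s' trans M s a s' * rs s' <= r ->
  (forall s', good F (f s') (rs s')) -> good F c r.
Proof.
move=> cf rsr /fin_all_exists [n0 h]; exists (\max_s' n0 s').+1 => -[//|n] hn /=.
rewrite cf; apply: le_trans rsr; apply: ler_sum => s' _.
apply: ler_wpM2l; first exact: trans_ge0.
by apply: h; apply: (@leq_trans (\max_s'' n0 s'')); [apply: leq_bigmax|].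
Qed.

Definition assertion := (nat -> nat -> nat) -> (nat -> nat -> R) -> R -> Prop.

(* [w] bounds the time taken by [c]; [r] is the budget against which the
   expected final loss [F] is charged, and [B] tells which budget suffices in
   each final memory. *)
Definition wp (c : cmd) (w : R) (B : assertion) : assertion := fun im rm r =>
  forall F k t q,
    (forall im' rm' t' q' r', B im' rm' r' -> t'%:R <= t%:R + w ->
       (q' + t <= q + t')%N -> good F (Config k im' rm' t' q') r') ->
    good F (Config (c :: k) im rm t q) r.

Lemma wp_mono c w w' (B B' : assertion) im rm r : wp c w B im rm r -> w <= w' ->
  (forall im' rm' r', B im' rm' r' -> B' im' rm' r') -> wp c w' B' im rm r.
Proof.
move=> cB ww' BB' F k t q h; apply: cB => im' rm' t' q' r' /BB' B'r tt' qq'.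
by apply: h => //; apply: le_trans tt' _; rewrite lerD2l.
Qed.

Lemma wp_seq c1 c2 w1 w2 w B im rm r : wp c1 w1 (wp c2 w2 B) im rm r ->
  w1 + w2 + 1 <= w -> wp (Seq c1 c2) w B im rm r.
Proof.
move=> h1 hw F k t q h; apply: good_goto => //; apply: h1.
move=> im1 rm1 t1 q1 r1 h2 tt1 qq1; apply: h2 => im2 rm2 t2 q2 r2 Br tt2 qq2.
apply: h => //; last lia.
by move: tt1; rewrite -addn1 natrD; lra.
Qed.

Fixpoint straight_cost (c : cmd) : nat :=
  match c with
  | Skip => 1
  | IAssign x i e => (icost i + icost e).+1
  | RAssign x i e => (icost i + rcost e).+1
  | Sample x i es ea => (icost i + icost es + icost ea + tau).+1
  | Seq c1 c2 => (straight_cost c1 + straight_cost c2).+1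
  | If b c1 c2 => ((bcost b).+1 + (straight_cost c1 + straight_cost c2))%N
  | While _ _ => 0
  end.

(** Reduces by computation to conditions on the memory. The case of [Sample] leaves open how the
    budget is split among the possible answers. *)
Fixpoint straight_wp (c : cmd) (B : assertion) : assertion := fun im rm r =>
  match c with
  | Skip => B im rm r
  | IAssign x i e =>
      [/\ isafe narr len im i, isafe narr len im e, allocated narr len x (ival im i) &
          B (update im x (ival im i) (ival im e)) rm r]
  | RAssign x i e =>
      [/\ isafe narr len im i, rsafe narr len im e, allocated narr len x (ival im i) &
          B im (update rm x (ival im i) (rval im rm e)) r]
  | Sample x i es ea =>
      [/\ isafe narr len im i, isafe narr len im es, isafe narr len im ea,
          allocated narr len x (ival im i) &
       exists s a, [/\ ival im es = enum_rank s, ival im ea = enum_rank a &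
        exists rs, \sum_s' trans M s a s' * rs s' <= r /\
        forall s', B (update im x (ival im i) (enum_rank s')) rm (rs s')]]
  | Seq c1 c2 => straight_wp c1 (straight_wp c2 B) im rm r
  | If b c1 c2 => bsafe narr len im b /\
      if bval im rm b then straight_wp c1 B im rm r else straight_wp c2 B im rm r
  | While _ _ => False
  end.

Lemma straight_wp_mono c (B B' : assertion) im rm r :
  (forall im' rm' r', B im' rm' r' -> B' im' rm' r') ->
  straight_wp c B im rm r -> straight_wp c B' im rm r.
Proof.
elim: c B B' im rm r => [|x i e|x i e|x i es ea|c1 IH1 c2 IH2|b c1 IH1 c2 IH2|b c _] B B'
  im rm r BB' //=.
- exact: BB'.
- by case=> *; split=> //; apply: BB'.
- by case=> *; split=> //; apply: BB'.
- case=> ? ? ? ? [s [a [es_s ea_a [rs [rsr h]]]]]; split=> //.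
  by exists s, a; split=> //; exists rs; split=> // s'; apply: BB'.
- by apply: IH1 => im' rm' r'; apply: IH2.
- by case=> hb; case: ifP => _ h; split=> //; [apply: IH1 h|apply: IH2 h].
Qed.

Lemma wp_straight c (w : R) B im rm r : straight_wp c B im rm r ->
  (straight_cost c)%:R <= w -> wp c w B im rm r.
Proof.
move=> hc hw; apply: (@wp_mono _ (straight_cost c)%:R _ B) => //; move: hc {hw}.
elim: c B im rm r => [|x i e|x i e|x i es ea|c1 IH1 c2 IH2|b c1 IH1 c2 IH2|b c _] B im rm
  r //=.
- move=> Br F k t q h; apply: good_goto => //; apply: h => //; last lia.
  by rewrite -natr1 lerD2l.
- case=> si se ai Br F k t q h; apply: good_goto.
    by rewrite /= (ievalE _ si) // (ievalE _ se) // ai.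
  by apply: h => //; [rewrite natrD|lia].
- case=> si se ai Br F k t q h; apply: good_goto.
    by rewrite /= (ievalE _ si) // (revalE _ se) // ai.
  by apply: h => //; [rewrite natrD|lia].
- case=> si ses sea ai [s [a [es_s ea_a [rs [rsr hB]]]]] F k t q h.
  apply: (@good_query _ _ s a _ rs) => //.
    rewrite /= (ievalE _ si) // (ievalE _ ses) // (ievalE _ sea) //= es_s ea_a.
    by rewrite !decode_rank ai.
  by move=> s'; apply: h => //; [rewrite natrD|lia].
- move=> h1; apply: (@wp_seq _ _ (straight_cost c1)%:R (straight_cost c2)%:R).
    by apply: IH1; apply: straight_wp_mono h1 => *; apply: IH2.
  by rewrite -natr1 natrD.
- case=> sb hb F k t q h; apply: good_goto; first by rewrite /= (bevalE _ sb).
  have le1 : (straight_cost c1)%:R <= (straight_cost c1 + straight_cost c2)%:R :> R by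
    rewrite ler_nat leq_addr.
  have le2 : (straight_cost c2)%:R <= (straight_cost c1 + straight_cost c2)%:R :> R by
    rewrite ler_nat leq_addl.
  move: hb; rewrite /=; case: ifP => _; [move=> /IH1|move=> /IH2];
    apply=> im' rm' t' q' r' Br tt' qq';
    (apply: h => //; last lia); move: tt' le1 le2; rewrite -!natr1 !natrD -!natr1; lra.
Qed.

Lemma good_while F b c k im rm t q r : bsafe narr len im b ->
  good F (Config (if bval im rm b then [:: c, While b c & k] else k) im rm
                 (t + (bcost b).+1) q) r ->
  good F (Config (While b c :: k) im rm t q) r.
Proof. by move=> sb; apply: good_goto; rewrite /= (bevalE _ sb). Qed.

(** The index of the invariant only bounds the number of iterations left: loops that test reals stop
    as soon as their test fails. *)
Lemma wp_while (I : nat -> assertion) b c wb B : 0 <= wb ->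
  (forall n im rm r, I n im rm r -> bsafe narr len im b /\
     if bval im rm b then (0 < n)%N /\ wp c wb (I n.-1) im rm r else B im rm r) ->
  forall n im rm r w, I n im rm r ->
    n%:R * (wb + (bcost b).+1%:R) + (bcost b).+1%:R <= w -> wp (While b c) w B im rm r.
Proof.
move=> wb0 hI n im rm r w Ir hw.
apply: (@wp_mono _ (n%:R * (wb + (bcost b).+1%:R) + (bcost b).+1%:R) _ B) => // {hw}.
elim: n im rm r Ir => [|n IH] im rm r /hI [sb].
  case: ifP => bv; first by case.
  move=> Br F k t q h; apply: good_while => //; rewrite bv.
  by apply: h => //; [rewrite natrD mul0r add0r|lia].
case: ifP => bv.
  case=> _ hc F k t q h; apply: good_while => //; rewrite bv.
  apply: hc => im' rm' t' q' r' /IH h' tt' qq';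
    apply: h' => im'' rm'' t'' q'' r'' Br tt'' qq''.
  apply: h => //; last lia.
  by apply: le_trans tt'' _; move: tt'; rewrite natrD -[n.+1%:R]natr1; lra.
move=> Br F k t q h; apply: good_while => //; rewrite bv.
apply: h => //; last lia.
rewrite natrD lerD2l lerDr mulr_ge0 //.
by rewrite addr_ge0 // ler0n.
Qed.

End Logic.

(** * Concentration and fixed points *)

(** [(1 - x) * expR x <= 1], while [1 - x] times the right-hand side is
    [1 + x ^+ 2 * (1 - 2 * x)]. *)
Lemma expR_le_quadratic (R : realType) (x : R) : x <= 1/2 -> expR x <= 1 + x + 2 * x ^+ 2.
Proof.
move=> hx; have h1 : 0 < 1 - x by lra.
have : 1 - x <= expR (- x) by apply: expR_ge1Dx.
rewrite expRN => h2.
have e0 := expR_gt0 x.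
have h3 : (1 - x) * expR x <= 1.
  by move: h2; rewrite -(ler_pM2r e0) mulVf ?lt0r_neq0.
rewrite -(ler_pM2l h1); apply: le_trans h3 _.
have -> : (1 - x) * (1 + x + 2 * x ^+ 2) = 1 + x ^+ 2 * (1 - 2 * x) by ring.
by rewrite lerDl mulr_ge0 ?sqr_ge0 //; lra.
Qed.

(** * Exponential moments of a lowered sample *)

Section Mean.
Context (R : realType) (S : finType) (p : S -> R).
Hypothesis p_ge0 : forall s, 0 <= p s.
Hypothesis p_sum1 : \sum_s p s = 1.

Definition mean (f : S -> R) : R := \sum_s p s * f s.

Lemma eq_mean f h : f =1 h -> mean f = mean h.
Proof. by move=> fh; apply: eq_bigr => s _; rewrite fh. Qed.

Lemma mean_le f h : (forall s, f s <= h s) -> mean f <= mean h.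
Proof. by move=> fh; apply: ler_sum => s _; apply: ler_wpM2l. Qed.

Lemma mean_cst c : mean (fun=> c) = c.
Proof. by rewrite /mean -mulr_suml p_sum1 mul1r. Qed.

Lemma meanD f h : mean (fun s => f s + h s) = mean f + mean h.
Proof. by rewrite /mean -big_split; apply: eq_bigr => s _; rewrite mulrDr. Qed.

Lemma meanZ c f : mean (fun s => c * f s) = c * mean f.
Proof. by rewrite /mean mulr_sumr; apply: eq_bigr => s _; rewrite mulrCA. Qed.

Lemma mean_ge0 f : (forall s, 0 <= f s) -> 0 <= mean f.
Proof. by move=> f0; rewrite -(mean_cst 0); apply: mean_le. Qed.

Lemma meanB f h : mean (fun s => f s - h s) = mean f - mean h.
Proof. by rewrite -[- mean h]mulN1r -meanZ -meanD; apply: eq_mean => s; rewrite mulN1r. Qed.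

Lemma mean_quadratic (y : S -> R) (c b a : R) :
  mean (fun s => c + b * y s + a * y s ^+ 2) = c + b * mean y + a * mean (fun s =>
    y s ^+ 2).
Proof. by rewrite !meanD mean_cst !meanZ. Qed.

Section Concentration.
Variables (y : S -> R) (c B k : R).
Hypothesis y_itv : forall s, 0 <= y s <= B.
Hypothesis c_itv : 0 <= c <= B.
Hypothesis k_gt0 : 0 < k.
Hypothesis kB : k * B <= 1/4.

Let mu := mean y.
Let D := mean (fun s => (y s - c) ^+ 2).
Let Z s := y s - k * (y s - c) ^+ 2.

Lemma mean_itv : 0 <= mu <= B.
Proof.
apply/andP; split; first by apply: mean_ge0 => s; case/andP: (y_itv s).
by rewrite -(mean_cst B); apply: mean_le => s; case/andP: (y_itv s).
Qed.

Let DE : D = mean (fun s => y s ^+ 2) - 2 * c * mu + c ^+ 2.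
Proof.
rewrite /D (@eq_mean _ (fun s => c ^+ 2 + (- 2 * c) * y s + 1 * y s ^+ 2)).
  by rewrite mean_quadratic -/mu; ring.
by move=> s; ring.
Qed.

Let D_ge_var : mean (fun s => y s ^+ 2) - mu ^+ 2 <= D.
Proof. by rewrite DE; have := sqr_ge0 (mu - c); nra. Qed.

Let kB_ge0 : 0 <= k * B.
Proof. by case/andP: c_itv => c0 cB; rewrite mulr_ge0 ?(ltW k_gt0) ?(le_trans c0). Qed.

Let kd_le s : k * (k * (y s - c) ^+ 2) <= 1/16.
Proof.
have /andP[y0 yB] := y_itv s; have /andP[c0 cB] := c_itv.
have d1 : (y s - c) ^+ 2 <= B ^+ 2.
  by rewrite -real_normK ?num_real // lerXn2r ?nnegrE ?normr_ge0 ?(le_trans y0) //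
    ler_norml; apply/andP; split; lra.
apply: (@le_trans _ _ ((k * B) ^+ 2)).
  by rewrite mulrA -expr2 exprMn ler_wpM2l ?sqr_ge0.
by move: kB kB_ge0; nra.
Qed.

Let square_bound s : (Z s - mu) ^+ 2 <= 2 * (y s - mu) ^+ 2 + 1/8 * (y s - c) ^+ 2.
Proof.
rewrite /Z; set x := y s - mu; set d := (y s - c) ^+ 2.
have d0 : 0 <= d := sqr_ge0 _.
have dB : k ^+ 2 * d <= 1/16 by rewrite expr2 -mulrA; apply: kd_le.
have -> : y s - k * d - mu = x - k * d by rewrite /x; ring.
have := sqr_ge0 (x + k * d).
by nra.
Qed.

(** The linear term contributes exactly the lowering [- e * k * D]. The variance is at most [D], so
    the quadratic terms sum to at most [2 * (2 + 1/8) = 17/4] times [e ^+ 2 * D]. *)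
Let mean_bound e : mean (fun s =>
  1 + e * (Z s - mu) + 2 * (e ^+ 2 * (2 * (y s - mu) ^+ 2 + 1/8 * (y s - c) ^+ 2)))
   <= 1 - e * k * D + e ^+ 2 * (17/4) * D.
Proof.
set m2 := mean (fun s => y s ^+ 2).
rewrite (@eq_mean _ (fun s =>
   (1 - e * mu - e * k * c ^+ 2 + 4 * e ^+ 2 * mu ^+ 2 + e ^+ 2 / 4 * c ^+ 2)
   + (e + 2 * e * k * c - 8 * e ^+ 2 * mu - e ^+ 2 / 2 * c) * y s
   + (- e * k + 4 * e ^+ 2 + e ^+ 2 / 4) * y s ^+ 2)); last by move=> s; rewrite /Z; field.
rewrite mean_quadratic -/mu -/m2.
have h : e ^+ 2 * (m2 - mu ^+ 2) <= e ^+ 2 * D by rewrite ler_wpM2l ?sqr_ge0.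
by move: h; rewrite DE -/m2; lra.
Qed.

Let D_ge0 : 0 <= D.
Proof. by apply: mean_ge0 => s; apply: sqr_ge0. Qed.

(** At exponent [k / 8] the lowering gains [k ^+ 2 / 8 * D], more than the quadratic loss
    [17/256 * k ^+ 2 * D]. *)
Lemma mean_expR_upper : mean (fun s => expR (k / 8 * (Z s - mu))) <= 1.
Proof.
apply: le_trans (le_trans (mean_bound (k / 8)) _).
  apply: mean_le => s; apply: le_trans (expR_le_quadratic _) _.
    have /andP[y0 yB] := y_itv s; have /andP[m0 mB] := mean_itv.
    have : k * y s <= k * B by rewrite ler_wpM2l // ltW.
    have : 0 <= k * mu by rewrite mulr_ge0 // ltW.
    have : 0 <= k * (k * (y s - c) ^+ 2) by do 2!apply: (mulr_ge0 (ltW k_gt0));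
      apply: sqr_ge0.
    by move: kB; rewrite /Z; lra.
  by rewrite lerD2l ler_wpM2l // exprMn ler_wpM2l ?sqr_ge0.
have : 0 <= k ^+ 2 * D by rewrite mulr_ge0 ?sqr_ge0.
by rewrite exprMn; lra.
Qed.

(** In the lower tail the lowering is harmful: it adds [k ^+ 2 / 8 * D] to the quadratic loss. The
    sum is below [k ^+ 2 / 4 * D], which the shift [2 * k * D] takes off the exponent. *)
Lemma mean_expR_lower : mean (fun s => expR (- (k / 8) * (Z s - mu + 2 * k * D))) <= 1.
Proof.
have e0 := expR_gt0 (k ^+ 2 / 4 * D).
rewrite (@eq_mean _ (fun s => (expR (k ^+ 2 / 4 * D))^-1 * expR (- (k / 8) * (Z s -
  mu)))); last first.
  by move=> s; rewrite -expRN -expRD; congr expR; field.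
rewrite meanZ ler_pdivrMl // mulr1.
apply: le_trans (le_trans (mean_bound (- (k / 8))) _).
  apply: mean_le => s; apply: le_trans (expR_le_quadratic _) _.
    have /andP[y0 yB] := y_itv s; have /andP[m0 mB] := mean_itv.
    have : k * mu <= k * B by rewrite ler_wpM2l // ltW.
    have : 0 <= k * y s by rewrite mulr_ge0 // ltW.
    have := kd_le s.
    by move: kB; rewrite /Z; lra.
  by rewrite lerD2l ler_wpM2l // exprMn ler_wpM2l ?sqr_ge0.
apply: le_trans (expR_ge1Dx _).
have : 0 <= k ^+ 2 * D by rewrite mulr_ge0 ?sqr_ge0.
by rewrite sqrrN exprMn; lra.
Qed.

End Concentration.
End Mean.

(** * Existence of fixed points and comparison of sub- and supersolutions *)

Section FixedPoint.
Context (R : realType) (S : finType) (T : {ffun S -> R} -> {ffun S -> R}) (H : R).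
Hypothesis T_mono : forall u w : {ffun S -> R}, (forall s, u s <= w s) ->
  forall s, T u s <= T w s.

(* Knaster-Tarski: the pointwise supremum of the [u <= T u] in the cube. *)
Lemma monotone_fixed_point : 0 <= H ->
  (forall u : {ffun S -> R}, (forall s, 0 <= u s <= H) -> forall s, 0 <= T u s <= H) ->
  exists v, T v = v.
Proof.
move=> H0 TH.
pose P := [set u : {ffun S -> R} | (forall s, 0 <= u s <= H) /\
  (forall s, u s <= T u s)]%classic.
pose v : {ffun S -> R} := [ffun s => sup [set u s | u in P]%classic].
have P0 : P 0.
  split=> [s|s]; first by rewrite ffunE lexx.
  have /andP[] : 0 <= T 0 s <= H by apply: TH => s'; rewrite ffunE lexx.
  by move=> h _; rewrite ffunE.
have ub s : ubound [set u s | u in P]%classic H by move=> _ [u [/(_ s)/andP[_ uH] _] <-].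
have ne s : ([set u s | u in P] !=set0)%classic by exists ((0 : {ffun S -> R}) s), 0.
have le_v u s : P u -> u s <= v s.
  by move=> Pu; rewrite ffunE; apply: ub_le_sup; [exists H; exact: ub|exists u].
have v_itv s : 0 <= v s <= H.
  apply/andP; split; first by have := le_v _ s P0; rewrite ffunE.
  by rewrite ffunE; apply: ge_sup.
have vT s : v s <= T v s.
  rewrite {1}ffunE; apply: ge_sup => // _ [u Pu <-].
  apply: le_trans (proj2 Pu s) _; apply: T_mono => s'; exact: le_v.
exists v; apply/ffunP => s; apply/le_anti/andP; split=> //.
by apply: le_v; split=> [s'|s']; [exact: TH|exact: T_mono].
Qed.

(** At a state where [x - y] is maximal, equal to [m], a positive [m] would satisfy [m <= g * m].
    Applied to two fixed points, this is uniqueness. *)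
Lemma fixed_point_compare (g : R) : g < 1 ->
  (forall (u : {ffun S -> R}) m s, 0 <= m -> T [ffun s' => u s' + m] s <= T u s + g * m) ->
  forall x y : {ffun S -> R}, (forall s, x s <= T x s) -> (forall s, T y s <= y s) ->
  forall s, x s <= y s.
Proof.
move=> g1 Tshift x y xT Ty s0.
case: (@Order.TotalTheory.arg_maxP _ _ _ s0 xpredT (fun s => x s - y s)) => // s _ hs.
set m := x s - y s; case: (lerP m 0) => [m0|m0].
  have /= := hs s0 isT; rewrite -/m; lra.
have h : T x s <= T y s + g * m.
  apply: le_trans (Tshift _ _ _ (ltW m0)); apply: T_mono => s'.
  by rewrite ffunE; have /= := hs s' isT; rewrite -/m; lra.
have := xT s; have := Ty s; rewrite /m in m0 h *; nra.
Qed.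

End FixedPoint.

(** * Bellman operators and the optimal value *)

Section Values.
Context (R : realType) (S A : finType) (M : dmdp R S A).
Hypothesis A_gt0 : (0 < #|A|)%N.

Let g := 1 - discount M.
Let H := g^-1.

Lemma gap_itv : 0 < g < 1.
Proof. by have /andP[h1 h2] := discount_itv M; rewrite /g; apply/andP; split; lra. Qed.

Let H_ge1 : 1 <= H.
Proof. by case/andP: gap_itv => g0 g1; rewrite /H -invr1 lef_pV2 ?posrE // ltW. Qed.

Let discountH : 1 + discount M * H = H.
Proof. by have /andP[/lt0r_neq0 g0 _] := gap_itv; rewrite /H; move: g0; rewrite /g => g0;
  field. Qed.

Lemma backupE u s a : backup M u s a = reward M s a + discount M * mean (trans M s a) u.
Proof. by []. Qed.

Lemma backup_mono (u w : {ffun S -> R}) s a :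
  (forall s', u s' <= w s') -> backup M u s a <= backup M w s a.
Proof.
move=> uw; rewrite !backupE lerD2l ler_wpM2l //;
  first by case/andP: (discount_itv M) => /ltW.
by apply: mean_le => // s'; apply: trans_ge0.
Qed.

Lemma backup_shift (u : {ffun S -> R}) m s a :
  backup M [ffun s' => u s' + m] s a = backup M u s a + discount M * m.
Proof.
rewrite !backupE -addrA -mulrDr -[in RHS](mean_cst (trans_sum1 M s a) m) -meanD.
by congr (_ + _ * _); apply: eq_mean => s'; rewrite ffunE.
Qed.

Lemma backup_itv (u : {ffun S -> R}) s a :
  (forall s', 0 <= u s' <= H) -> 0 <= backup M u s a <= H.
Proof.
move=> uH; rewrite backupE.
have /andP[h1 h2] : 0 <= mean (trans M s a) u <= H.
  by apply: mean_itv => // *; [apply: trans_ge0|apply: trans_sum1].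
have /andP[r0 r1] := reward_itv M s a; have /andP[d0 d1] := discount_itv M.
apply/andP; split; first by rewrite addr_ge0 ?mulr_ge0 // ltW.
by rewrite -[leRHS]discountH lerD // ler_pM2l.
Qed.

Lemma bellmanP u s :
  (exists a, bellman M u s = backup M u s a) /\ forall a, backup M u s a <= bellman M u s.
Proof.
have /card_gt0P[a0 _] := A_gt0.
case: (@Order.TotalTheory.arg_maxP _ _ _ a0 xpredT (backup M u s)) => // a _ ha.
have E : bellman M u s = backup M u s a.
  rewrite ffunE; apply/le_anti/andP; split.
    by apply: ge_sup => [|_ [b _ <-]]; [exists (backup M u s a); exists a|exact: ha].
  by apply: ub_le_sup; [exists (backup M u s a) => _ [b _ <-]; exact: ha|exists a].
by split=> [|b]; [exists a|rewrite E; exact: ha].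
Qed.

Lemma bellman_mono (u w : {ffun S -> R}) :
  (forall s, u s <= w s) -> forall s, bellman M u s <= bellman M w s.
Proof.
move=> uw s; have [[a ->] _] := bellmanP u s.
by apply: le_trans (proj2 (bellmanP w s) a); apply: backup_mono.
Qed.

Lemma bellman_policy_mono pi (u w : {ffun S -> R}) :
  (forall s, u s <= w s) -> forall s, bellman_policy M pi u s <= bellman_policy M pi w s.
Proof. by move=> uw s; rewrite !ffunE; apply: backup_mono. Qed.

Lemma bellman_compare (x y : {ffun S -> R}) :
  (forall s, x s <= bellman M x s) -> (forall s, bellman M y s <= y s) ->
  forall s, x s <= y s.
Proof.
have /andP[d0 d1] := discount_itv M.
apply: (fixed_point_compare bellman_mono d1) => u m s m0.
have [[a ->] _] := bellmanP [ffun s' => u s' + m] s.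
by rewrite backup_shift lerD2r; apply: (proj2 (bellmanP u s)).
Qed.

Lemma optimal_value_fixed : bellman M (optimal_value M) = optimal_value M.
Proof.
have [|u uH s|v hv] := @monotone_fixed_point _ _ _ H bellman_mono.
- by apply: le_trans H_ge1.
- by have [[a ->] _] := bellmanP u s; apply: backup_itv.
by rewrite /optimal_value; case: xgetP => [w -> //|/(_ v)[]].
Qed.

Lemma policy_value_fixed pi : bellman_policy M pi (policy_value M pi) = policy_value M pi.
Proof.
have [|u uH s|v hv] := @monotone_fixed_point _ _ _ H (@bellman_policy_mono pi).
- by apply: le_trans H_ge1.
- by rewrite ffunE; apply: backup_itv.
by rewrite /policy_value; case: xgetP => [w -> //|/(_ v)[]].
Qed.

Let V := optimal_value M.

Lemma optimal_value_greedy s : exists a, V s = backup M V s a.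
Proof. by have [[a h] _] := bellmanP V s; exists a; rewrite -h optimal_value_fixed. Qed.

Lemma optimal_value_itv s : 0 <= V s <= H.
Proof.
apply/andP; split.
  rewrite -[leLHS](ffunE (fun=> 0) s); apply: bellman_compare => s';
    last by rewrite optimal_value_fixed.
  have [[a ->] _] := bellmanP [ffun=> 0] s'.
  rewrite ffunE; have /andP[] // : 0 <= backup M [ffun=> 0] s' a <= H.
by apply: backup_itv => s2; rewrite ffunE lexx (le_trans _ H_ge1).
rewrite -[leRHS](ffunE (fun=> H) s); apply: bellman_compare => s';
  first by rewrite optimal_value_fixed.
have [[a ->] _] := bellmanP [ffun=> H] s'.
rewrite [leRHS]ffunE; have /andP[] // : 0 <= backup M [ffun=> H] s' a <= H.
by apply: backup_itv => s2; rewrite ffunE lexx (le_trans _ H_ge1).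
Qed.

Lemma policy_value_between (pi : S -> A) (v : {ffun S -> R}) :
  (forall s, v s <= backup M v s (pi s)) ->
  forall s, v s <= policy_value M pi s <= V s.
Proof.
move=> hv s; have /andP[d0 d1] := discount_itv M; apply/andP; split.
  apply: (fixed_point_compare (@bellman_policy_mono pi) d1) => [u m s' _|s'|s'].
  - by rewrite !ffunE backup_shift.
  - by rewrite ffunE.
  - by rewrite policy_value_fixed.
apply: bellman_compare => s'; last by rewrite optimal_value_fixed.
rewrite -{1}policy_value_fixed ffunE; exact: (proj2 (bellmanP _ _)).
Qed.

(* A discounted form of the law of total variance: the right-hand side
   telescopes when summed along the greedy policy. *)
Lemma greedy_dispersion s a : V s = backup M V s a ->
  discount M * mean (trans M s a) (fun s' => (V s' - V s) ^+ 2)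
    <= discount M * mean (trans M s a) (fun s' => V s' ^+ 2) - V s ^+ 2 + 2 * H.
Proof.
move=> hV; rewrite (@eq_mean _ _ _ _ (fun s' =>
  V s ^+ 2 + (- 2 * V s) * V s' + 1 * V s' ^+ 2)); last first.
  by move=> s'; ring.
rewrite mean_quadratic; last exact: trans_sum1.
have := hV; rewrite backupE; set m := mean _ (fun s => V s); set m2 := mean _ _ => hV'.
have /andP[d0 d1] := discount_itv M; have /andP[r0 r1] := reward_itv M s a.
have /andP[V0 VH] := optimal_value_itv s.
(* The fixed point equation eliminates the mean of [V]. The cross term becomes [- 2 * V s ^+ 2] plus
   [2 * V s * reward M s a], and the latter is the [2 * H] of the statement. *)
have e : discount M * m = V s - reward M s a by rewrite hV'; ring.
have -> : discount M * (V s ^+ 2 + - 2 * V s * m + 1 * m2) =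
  discount M * V s ^+ 2 - 2 * V s * (discount M * m) + discount M * m2 by ring.
rewrite e.
have h1 : V s * reward M s a <= V s by rewrite ler_piMr.
have h2 : discount M * V s ^+ 2 <= V s ^+ 2 by rewrite ler_piMl ?sqr_ge0 // ltW.
by move: h1 h2; lra.
Qed.

End Values.

(** * Powers of two, logarithms and geometric decay *)

Section Logarithms.
Context (R : realType).

Lemma expR1_ge2 : 2 <= expR 1 :> R.
Proof. exact: expR_ge1Dx. Qed.

Lemma natr_le_pow2 n : n%:R <= 2 ^+ n :> R.
Proof.
elim: n => [|n IH]; first by rewrite expr0.
rewrite -natr1 exprS mulr_natl mulr2n lerD //.
by rewrite exprn_ege1 // ler1n.
Qed.

(** [n] is the number of halvings that bring [x] to at most 1: it will bound the iterations of the
    confidence loop and the number of epochs. *)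
Lemma pow2_bracket (x : R) :
  exists n, x <= 2 ^+ n /\ (n = 0%N \/ 2 ^+ n.-1 <= x).
Proof.
have ex : exists n, x <= 2 ^+ n.
  exists (Num.truncn x).+1; apply: le_trans (natr_le_pow2 _).
  case: (lerP 0 x) => x0; last by rewrite (le_trans (ltW x0)).
  by rewrite ltW // truncnS_gt.
case: (ex_minnP ex) => n hn hmin; exists n; split=> //.
case: n hn hmin => [|n] hn hmin; [by left|right].
by rewrite leNgt; apply/negP => /ltW /hmin; rewrite ltnn.
Qed.

(** [expR (1/2) <= 2], so [n - 1 <= 2 * ln x]; the additional 1 is absorbed by the truncation of the
    logarithm. *)
Lemma pow2_bracket_ln (x : R) n : 0 < x -> n = 0%N \/ 2 ^+ n.-1 <= x ->
  n%:R <= 3 * Num.max 1 (ln x).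
Proof.
move=> x0 [->|]; first by rewrite mulr_ge0 // le_max ler01.
case: n => [_|n] /=; first by rewrite mulr_ge0 // le_max ler01.
move=> hx; have h2 : expR (n%:R / 2) <= x.
  apply: le_trans hx; rewrite mulrC expRM_natr lerXn2r ?nnegrE ?expR_ge0 //.
  have h : 1 - 2^-1 <= expR (- 2^-1) :> R by apply: expR_ge1Dx.
  rewrite expRN in h; have e0 := expR_gt0 (2^-1 : R).
  have : (1 - 2^-1) * expR 2^-1 <= 1 :> R by rewrite -ler_pdivlMr // div1r.
  lra.
have : n%:R / 2 <= ln x by rewrite -[leLHS]expRK ler_ln // posrE expR_gt0.
have : 1 <= Num.max 1 (ln x) by rewrite le_max lexx.
have : ln x <= Num.max 1 (ln x) by rewrite le_max lexx orbT.
by rewrite -[n.+1%:R]natr1; lra.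
Qed.

Lemma bernoulli_decay (g : R) k : 0 <= g <= 1 -> (1 - g) ^+ k * (1 + k%:R * g) <= 1.
Proof.
case/andP=> g0 g1; elim: k => [|k IH]; first by rewrite mul0r addr0 mulr1 expr0.
apply: le_trans IH; rewrite exprSr -mulrA ler_wpM2l ?exprn_ge0 ?subr_ge0 //.
rewrite -natr1; have : 0 <= k%:R * g ^+ 2 by rewrite mulr_ge0 ?sqr_ge0.
by have := sqr_ge0 g; nra.
Qed.

(** The factor [1 + k * g] of the Bernoulli bound is then at least 4. This fixes the number of
    sweeps of an epoch. *)
Lemma quarter_decay (g : R) k : 0 < g < 1 -> 3 / g <= k%:R -> (1 - g) ^+ k <= 1/4.
Proof.
case/andP=> g0 g1 hk; have h : 3 <= k%:R * g by rewrite -ler_pdivrMr.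
have := @bernoulli_decay g k; rewrite (ltW g0) (ltW g1) => /(_ isT).
have : 0 <= (1 - g) ^+ k by rewrite exprn_ge0 // subr_ge0 ltW.
by nra.
Qed.

End Logarithms.

(** * Error recursion inside one epoch *)

Section Epoch.
Context (R : realType) (S A : finType) (M : dmdp R S A).
Hypothesis A_gt0 : (0 < #|A|)%N.
Variables (eps u : R).
Hypothesis eps_itv : 0 < eps < 1.

Let V := optimal_value M.
Let g := 1 - discount M.
Let H := g^-1.

Hypothesis u_itv : eps < u <= H.

(** With the constants of these four parameters, the error at the end of an epoch is at most [u / 4]
    from the decay of the initial error, [u / 8] from [xi * H] and [u / 16] from the coarse
    lowering, hence below [u / 2]. *)
Definition coarse_scale : R := g ^+ 2 * eps / 128.
Definition coarse_margin : R := g * eps / 64.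
Definition fine_scale : R := g / (64 * u).
Definition fine_margin : R := g * u / 64.

Let k1 := coarse_scale.
Let b1 := coarse_margin.
Let k2 := fine_scale.
Let b2 := fine_margin.
(** Each margin counts twice: an estimate may err by it and is then lowered by it. The first term is
    the price of replacing the dispersion of [v0] by that of the optimal value. *)
Let xi := 4 * k1 * u ^+ 2 + 2 * b1 + 2 * k2 * u ^+ 2 + 2 * b2.

(* Dominates [V - v] after [i] sweeps; the last two terms are a supersolution
   of the error recursion along the greedy policy. *)
Definition sweep_error (i : nat) (s : S) : R :=
  discount M ^+ i * u + xi * H + 4 * k1 * (2 * H ^+ 2 - V s ^+ 2).

Let g_itv : 0 < g < 1. Proof. exact: gap_itv. Qed.
Let gH : g * H = 1. Proof. by case/andP: g_itv => g0 _; rewrite mulfV ?lt0r_neq0. Qed.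
Let H_ge1 : 1 <= H. Proof. by case/andP: g_itv => g0 g1;
  rewrite /H -invr1 lef_pV2 ?posrE // ltW. Qed.
Let u_gt0 : 0 < u. Proof. by case/andP: eps_itv => e0 _; case/andP: u_itv => h _; lra. Qed.
Lemma coarse_scale_gt0 : 0 < k1.
Proof. by case/andP: eps_itv => e0 _; case/andP: g_itv => g0 _;
  rewrite divr_gt0 ?mulr_gt0 ?exprn_gt0. Qed.
Lemma fine_scale_gt0 : 0 < k2.
Proof. by case/andP: g_itv => g0 _; rewrite divr_gt0 ?mulr_gt0. Qed.
Let k2u : k2 * u ^+ 2 = g * u / 64.
Proof. by rewrite /k2 /fine_scale; field; exact: lt0r_neq0. Qed.

Lemma coarse_scale_bound : k1 * H <= 1/4.
Proof.
rewrite /k1 /coarse_scale expr2.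
have -> : g * g * eps / 128 * H = (g * H) * (g * eps / 128) by ring.
by rewrite gH; case/andP: eps_itv; case/andP: g_itv; nra.
Qed.

Lemma fine_scale_bound : k2 * u <= 1/4.
Proof.
have -> : k2 * u = g / 64 by rewrite /k2 /fine_scale; field; exact: lt0r_neq0.
by case/andP: g_itv; lra.
Qed.

Lemma coarse_margin_gt0 : 0 < b1.
Proof. by case/andP: eps_itv => e0 _; case/andP: g_itv => g0 _;
  rewrite divr_gt0 ?mulr_gt0. Qed.

Lemma fine_margin_gt0 : 0 < b2.
Proof. by case/andP: g_itv => g0 _; rewrite divr_gt0 ?mulr_gt0. Qed.

Let xi_ge0 : 0 <= xi.
Proof.
have h1 : 0 <= k1 * u ^+ 2 by apply: mulr_ge0 (ltW coarse_scale_gt0) (sqr_ge0 _).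
have h2 : 0 <= k2 * u ^+ 2 by apply: mulr_ge0 (ltW fine_scale_gt0) (sqr_ge0 _).
by have := coarse_margin_gt0; have := fine_margin_gt0; rewrite /xi; lra.
Qed.

Lemma sweep_error0 s : u <= sweep_error 0 s.
Proof.
have /andP[V0 VH] := optimal_value_itv M A_gt0 s.
have h1 : V s ^+ 2 <= H ^+ 2 by rewrite lerXn2r ?nnegrE ?(le_trans V0).
have h2 : 0 <= k1 * (2 * H ^+ 2 - V s ^+ 2).
  by apply: mulr_ge0 (ltW coarse_scale_gt0) _; have := sqr_ge0 H; lra.
have h3 : 0 <= xi * H by apply: mulr_ge0 => //; apply: le_trans H_ge1.
by rewrite /sweep_error expr0 mul1r; lra.
Qed.

(** Along a greedy action the error obeys a discounted recursion whose source is [xi] plus [4 * k1]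
    times the dispersion of [V]. The first is absorbed by [xi * H], the second, through
    [greedy_dispersion], by the term in [V s ^+ 2]. *)
Lemma sweep_error_step (v0 v : S -> R) i s a q : V s = backup M V s a ->
  (forall s', 0 <= V s' - v0 s' <= u) ->
  (forall s', 0 <= v s' - v0 s' <= u) ->
  (forall s', V s' - v s' <= sweep_error i s') ->
  reward M s a + discount M *
    (mean (trans M s a) v
     - 2 * k1 * mean (trans M s a) (fun s' => (v0 s' - v0 s) ^+ 2) - 2 * b1
     - 2 * k2 * mean (trans M s a) (fun s' =>
       (v s' - v0 s' - (v s - v0 s)) ^+ 2) - 2 * b2) <= q ->
  V s - q <= sweep_error i.+1 s.
Proof.
move=> Va hv0 hv hi hq; have P0 := @trans_ge0 _ _ _ M s a; have P1 := trans_sum1 M s a.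
have /andP[d0 d1] := discount_itv M.
(* [v0 s' - v0 s] and [V s' - V s] differ by a difference of two numbers between 0 and [u]; then
   [(a - b) ^+ 2 <= 2 * a ^+ 2 + 2 * b ^+ 2]. *)
have D0 : mean (trans M s a) (fun s' => (v0 s' - v0 s) ^+ 2)
    <= 2 * mean (trans M s a) (fun s' => (V s' - V s) ^+ 2) + 2 * u ^+ 2.
  rewrite -meanZ -[2 * u ^+ 2](mean_cst P1) -meanD; apply: mean_le => // s'.
  have /andP[h1 h2] := hv0 s; have /andP[h3 h4] := hv0 s'.
  set e := V s - v0 s in h1 h2 *; set e' := V s' - v0 s' in h3 h4 *.
  have -> : v0 s' - v0 s = (V s' - V s) - (e' - e) by rewrite /e /e'; ring.
  have : (e' - e) ^+ 2 <= u ^+ 2.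
    by rewrite -[leLHS]real_normK ?num_real // lerXn2r ?nnegrE ?normr_ge0 ?(ltW u_gt0) //
      ler_norml; apply/andP; split; lra.
  have := sqr_ge0 (V s' - V s + (e' - e)); nra.
have D2 : mean (trans M s a) (fun s' => (v s' - v0 s' - (v s - v0 s)) ^+ 2) <= u ^+ 2.
  rewrite -[u ^+ 2](mean_cst P1); apply: mean_le => // s'.
  have /andP[h1 h2] := hv s; have /andP[h3 h4] := hv s'.
  by rewrite -[leLHS]real_normK ?num_real // lerXn2r ?nnegrE ?normr_ge0 ?(ltW u_gt0) //
    ler_norml; apply/andP; split; lra.
have hE : mean (trans M s a) V - mean (trans M s a) v <=
    discount M ^+ i * u + xi * H + 4 * k1 * (2 * H ^+ 2 - mean (trans M s a) (fun s' =>
      V s' ^+ 2)).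
  rewrite -meanB -[X in _ <= _ + _ * (X - _)](mean_cst P1) -meanB -meanZ.
  by rewrite -[X in X + _](mean_cst P1) -meanD; apply: mean_le => // s'; exact: hi.
have hG := greedy_dispersion A_gt0 Va.
rewrite -/V -/g -/H in hG.
move: hq; have := Va; rewrite backupE.
set m2 := mean _ (fun s' => V s' ^+ 2) in hE hG *.
set Dv := mean _ (fun s' => (V s' - V s) ^+ 2) in D0 hG *.
set m := mean _ V in hE *; set mv := mean _ v in hE *.
set d0' := mean _ (fun s' => (v0 s' - v0 s) ^+ 2) in D0 *.
set d2' := mean _ _ in D2 *.
move=> Vs hq.
have c0 : k1 * d0' <= k1 * (2 * Dv + 2 * u ^+ 2) by rewrite ler_pM2l ?coarse_scale_gt0.
have c2 : k2 * d2' <= k2 * u ^+ 2 by rewrite ler_pM2l ?fine_scale_gt0.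
have step1 : V s - q <= discount M * (discount M ^+ i * u + xi * H + 4 * k1 * (2 * H ^+ 2
  - m2) + 4 * k1 * Dv + xi).
  apply: (@le_trans _ _ (discount M * (m - mv + 2 * k1 * d0' + 2 * b1 + 2 * k2 * d2' + 2
    * b2))).
    by move: hq Vs; lra.
  by rewrite ler_pM2l //; rewrite /xi in hE *; lra.
apply: le_trans step1 _; rewrite /sweep_error (exprS (discount M)).
have c3 : k1 * (discount M * Dv) <= k1 * (discount M * m2 - V s ^+ 2 + 2 * H) by rewrite
  ler_pM2l ?coarse_scale_gt0.
have gE : discount M = 1 - g by rewrite /g; ring.
have c4 : discount M * xi <= xi by rewrite ler_piMl // ltW.
have c5 : discount M * (xi * H) = xi * H - xi.
  by rewrite gE; transitivity (xi * H - xi * (g * H)); [ring|rewrite gH mulr1].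
(* Discounting [2 * H ^+ 2] releases exactly the [2 * H] lost in [greedy_dispersion]. *)
have c6 : discount M * H ^+ 2 = H ^+ 2 - H.
  by rewrite gE; transitivity (H ^+ 2 - (g * H) * H); [ring|rewrite gH mul1r].
have -> : discount M * (discount M ^+ i * u + xi * H + 4 * k1 * (2 * H ^+ 2 - m2) + 4 *
  k1 * Dv + xi)
  = discount M * discount M ^+ i * u + discount M * (xi * H) + 4 * k1 * (2 * (discount M
    * H ^+ 2) - discount M * m2)
    + 4 * (k1 * (discount M * Dv)) + discount M * xi by ring.
by rewrite c5 c6; lra.
Qed.

Lemma sweep_error_half i s : 3 / g <= i%:R -> sweep_error i s <= u / 2.
Proof.
move=> hi; have := quarter_decay g_itv hi; rewrite /sweep_error.
have -> : 1 - g = discount M by rewrite /g; ring.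
set di := discount M ^+ i => hd.
have /andP[g0 g1] := g_itv; have /andP[e0 e1] := eps_itv; have /andP[eu uH] := u_itv.
have a1 : di * u <= u / 4 by rewrite -[u / 4]mulrC ler_pM2r //; lra.
have a2 : k1 * H ^+ 2 = eps / 128.
  by rewrite /k1 /coarse_scale; transitivity ((g * H) ^+ 2 * eps / 128);
    [ring|rewrite gH expr1n mul1r].
have gu : g * u <= 1 by rewrite -gH ler_pM2l.
have a3 : k1 * u ^+ 2 * H <= u / 128.
  have -> : k1 * u ^+ 2 * H = (g * H) * (g * u * (eps * u)) / 128.
    by rewrite /k1 /coarse_scale; ring.
  rewrite gH mul1r ler_pM2r ?invr_gt0 //.
  apply: (@le_trans _ _ (1 * u)); last by rewrite mul1r.
  apply: ler_pM => //; rewrite ?mulr_ge0 // ?ltW //.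
  by rewrite -[ltRHS]mul1r ltr_pM2r.
have a4 : b1 * H = eps / 64 by rewrite /b1 /coarse_margin;
  transitivity ((g * H) * eps / 64); [ring|rewrite gH mul1r].
have a5 : k2 * u ^+ 2 * H = u / 64.
  by rewrite k2u; transitivity ((g * H) * u / 64); [ring|rewrite gH mul1r].
have a6 : b2 * H = u / 64 by rewrite /b2 /fine_margin; transitivity ((g * H) * u / 64);
  [ring|rewrite gH mul1r].
have a7 : 0 <= k1 * V s ^+ 2 by apply: mulr_ge0 (ltW coarse_scale_gt0) (sqr_ge0 _).
have -> : xi * H = 4 * (k1 * u ^+ 2 * H) + 2 * (b1 * H) + 2 * (k2 * u ^+ 2 * H) +
  2 * (b2 * H) by rewrite /xi; ring.
by move: a1 a2 a3 a4 a5 a6 a7 eu; lra.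
Qed.

End Epoch.

(** * The algorithm *)

(* Integer arrays: 2 policy, 3 state, 4 action, 5 index of the pair (state,
   action), 6 sampled state. Real arrays: 4 reference value [v0], 5 increment
   [d] of the value over [v0], 6 estimates of the means of [v0], 7 confidence
   level [L], 8 error bound [u], 9 scale, 10 margin, 11 sample size, 12 sum of
   the samples, 13 number of samples, 14 number of sweeps, 15 auxiliary. *)
Definition ivar (x : nat) : iexp := ICell x (IConst 0).
Definition rvar (x : nat) : rexp := RCell x (IConst 0).
Definition iset (x : nat) (e : iexp) : cmd := IAssign x (IConst 0) e.
Definition rset (x : nat) (e : rexp) : cmd := RAssign x (IConst 0) e.

(** Array 5 is a running counter because the successor alone cannot form the row-major index of a
    pair. *)
Definition foreach_pair (c : cmd) : cmd :=
  Seq (iset 5 (IConst 0)) (Seq (iset 3 (IConst 0))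
  (While (BILt (ivar 3) (ivar 0))
    (Seq (iset 4 (IConst 0))
    (Seq (While (BILt (ivar 4) (ivar 1))
      (Seq c (Seq (iset 4 (ISucc (ivar 4))) (iset 5 (ISucc (ivar 5))))))
    (iset 3 (ISucc (ivar 3))))))).

(** The samples are counted in a real cell, since the sample size is a real that cannot be rounded;
    summing them on the fly takes constant space. *)
Definition estimate (x : nat) : cmd :=
  let d := RSub (RCell x (ivar 6)) (RCell x (ivar 3)) in
  Seq (rset 12 (RConst 0)) (Seq (rset 13 (RConst 0))
  (While (BRLt (rvar 13) (rvar 11))
    (Seq (Sample 6 (IConst 0) (ivar 3) (ivar 4))
    (Seq (rset 12 (RAdd (rvar 12)
           (RSub (RCell x (ivar 6)) (RMul (rvar 9) (RMul d d)))))
         (rset 13 (RAdd (rvar 13) (RConst 1))))))).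

(** Either a failure has occurred and [r] pays the whole loss [lam], or [P] holds so far and [x]
    bounds the probability of a later failure. *)
Definition budget (R : realType) (lam x : R) (P : Prop) (r : R) : Prop :=
  lam <= r \/ (lam * x <= r /\ P).

(** * Traversal of the pairs and estimation of one mean *)

Section Program.
Context (R : realType) (S A : finType) (M : dmdp R S A) (tau : nat).
Hypothesis S_gt0 : (0 < #|S|)%N.
Hypothesis A_gt0 : (0 < #|A|)%N.

Let len := (#|S| * #|A|)%N.
Let wp := wp M 16 len tau.
Let W : R := (100 + tau)%:R.

Let W_ge100 : 100 <= W. Proof. by rewrite /W ler_nat leq_addr. Qed.

Lemma wp_straight_const c B im rm r (w : R) : straight_wp M 16 len c B im rm r ->
  (straight_cost tau c <= 80 + tau)%N -> W - 20 <= w -> wp c w B im rm r.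
Proof.
move=> hc hcost hw; apply: wp_straight hc _; apply: le_trans hw.
rewrite -(ler_nat R) in hcost; apply: le_trans hcost _.
by rewrite /W !natrD; lra.
Qed.

Lemma allocated0 x : (x < 16)%N -> allocated 16 len x 0.
Proof. by rewrite /allocated => ->; rewrite muln_gt0 S_gt0. Qed.

Lemma allocated_state x (s : S) : (x < 16)%N -> allocated 16 len x (enum_rank s).
Proof.
by rewrite /allocated => -> /=; apply: leq_trans (ltn_ord _) _; rewrite leq_pmulr.
Qed.

Definition pair_index (s : S) (a : A) : nat := (enum_rank s * #|A| + enum_rank a)%N.

Lemma pair_index_lt s a : (pair_index s a < len)%N.
Proof.
have h1 := ltn_ord (enum_rank s); have h2 := ltn_ord (enum_rank a).
have : (enum_rank s * #|A| + #|A| <= len)%N by rewrite -mulSnr leq_mul2r h1 orbT.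
by apply: leq_trans; rewrite ltn_add2l.
Qed.

Lemma allocated_pair x s a : (x < 16)%N -> allocated 16 len x (pair_index s a).
Proof. by rewrite /allocated pair_index_lt => ->. Qed.

Lemma rank_onto (T : finType) i : (i < #|T|)%N -> exists x : T, i = enum_rank x.
Proof. by move=> hi; exists (enum_val (Ordinal hi)); rewrite enum_valK. Qed.

Definition sized (im : nat -> nat -> nat) : Prop := im 0%N 0%N = #|S| /\ im 1%N 0%N = #|A|.

(* [J] sees the integer memory only through the policy, so that it is not
   affected by the loop counters. *)
Lemma wp_foreach (nS nA : nat) (J : nat -> (nat -> nat) -> (nat -> nat -> R) -> R -> Prop)
    (c : cmd) (wb : R) im rm r : (0 < nS)%N -> (0 < nA)%N -> 0 <= wb ->
  (forall i j im rm r, (i < nS)%N -> (j < nA)%N -> im 0%N 0%N = nS -> im 1%N 0%N = nA ->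
     im 3%N 0%N = i -> im 4%N 0%N = j -> im 5%N 0%N = (i * nA + j)%N ->
     J (i * nA + j)%N (im 2%N) rm r ->
     wp c wb (fun im' rm' r' => J (i * nA + j).+1 (im' 2%N) rm' r' /\
        forall x, x != 2%N -> x != 6%N -> im' x = im x) im rm r) ->
  im 0%N 0%N = nS -> im 1%N 0%N = nA -> J 0%N (im 2%N) rm r ->
  wp (foreach_pair c) ((nS * nA)%:R * (wb + 100))
    (fun im' rm' r' => [/\ J (nS * nA)%N (im' 2%N) rm' r', im' 0%N 0%N = nS & im' 1%N 0%N
      = nA])
    im rm r.
Proof.
move=> S0 A0 wb0 hc im0 im1 J0.
have a0 := fun x => @allocated0 x.
have S1 : 1 <= nS%:R :> R by rewrite ler1n.
have A1 : 1 <= nA%:R :> R by rewrite ler1n.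
have SA : nS%:R <= nS%:R * nA%:R :> R by rewrite ler_peMr // (le_trans ler01).
have wbS : 0 <= nS%:R * nA%:R * wb by rewrite !mulr_ge0.
rewrite natrM; set w := (X in wp _ X).
pose I n : assertion R := fun im rm r => [/\ im 0%N 0%N = nS /\ im 1%N 0%N = nA,
  im 3%N 0%N = (nS - n)%N, (n <= nS)%N,
  im 5%N 0%N = ((nS - n) * nA)%N & J ((nS - n) * nA)%N (im 2%N) rm r].
pose wi := nA%:R * (wb + 20) + 20.
apply: (@wp_seq _ _ _ _ _ _ _ _ _ 3 (w - 4)); last by lra.
apply: wp_straight => /=; last (by rewrite ler_nat); split=> //; first exact: a0.
apply: (@wp_seq _ _ _ _ _ _ _ _ _ 3 (w - 8)); last by lra.
apply: wp_straight => /=; last (by rewrite ler_nat); split=> //; first exact: a0.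
apply: (@wp_while _ _ _ _ _ _ _ I _ _ wi _ _ _ nS).
- by rewrite /wi addr_ge0 ?mulr_ge0 ?addr_ge0.
- move=> n {im0 im1 J0} im1 rm1 r1 [[s0 s1] i3 nS_n i5 Jn] /=; rewrite s0 i3.
  split; first by do !split=> //; apply: a0.
  case: ltnP => hn; last first.
    by have n0 : n = 0%N; [lia|move: Jn; rewrite n0 subn0; split].
  have n_gt0 : (0 < n)%N by lia.
  split=> //; set i := (nS - n)%N in hn i3 i5 Jn.
  pose I' m : assertion R := fun im rm r => [/\ [/\
    im 0%N 0%N = nS, im 1%N 0%N = nA & im 3%N 0%N = i],
    im 4%N 0%N = (nA - m)%N, (m <= nA)%N, im 5%N 0%N = (i * nA + (nA - m))%N &
    J (i * nA + (nA - m))%N (im 2%N) rm r].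
  apply: (@wp_seq _ _ _ _ _ _ _ _ _ 3 (wi - 4)); last by rewrite /wi; lra.
  apply: wp_straight => /=; last (by rewrite ler_nat); split=> //; first exact: a0.
  apply: (@wp_seq _ _ _ _ _ _ _ _ _ (wi - 10) 5); last by rewrite /wi; lra.
  apply: (@wp_while _ _ _ _ _ _ _ I' _ _ (wb + 13) _ _ _ nA).
  + by rewrite addr_ge0.
  + move=> m im2 rm2 r2 [[z0 z1 j3] j4 mA j5 Jm] /=; rewrite z1 j4.
    split; first by do !split=> //; apply: a0.
    case: ltnP => hm; last first.
      have m0 : m = 0%N by lia.
      apply: wp_straight => /=; last by rewrite ler_nat.
      split=> //; try (by split=> //; apply: a0); try exact: a0.
      have ei : (nS - n.-1 = i.+1)%N by lia.
      rewrite /I ei; split=> //=; rewrite /update /=.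
      * by rewrite j3.
      * by lia.
      * by rewrite j5 m0; lia.
      * by move: Jm; rewrite m0; congr (J _ _ _ _); lia.
    have m_gt0 : (0 < m)%N by lia.
    split=> //.
    apply: (@wp_seq _ _ _ _ _ _ _ _ _ wb 12); last by lra.
    apply: wp_mono (hc i (nA - m)%N im2 rm2 r2 _ _ _ _ _ _ _ _) _ _ => //.
    move=> im3 rm3 r3 [J3 e]; apply: wp_straight => /=; last by rewrite ler_nat.
    split=> //; try (by split=> //; apply: a0); try exact: a0.
    split=> //; try (by split=> //; apply: a0); try exact: a0.
    have em : (nA - m.-1 = (nA - m).+1)%N by lia.
    rewrite /I' em; split=> //=; rewrite /update /= 1?(e 0%N) 1?(e 1%N) 1?(e 3%N) 1?(e
      4%N) 1?(e 5%N) //.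
    * by rewrite j4.
    * by lia.
    * by rewrite j5; lia.
    * by move: J3; rewrite addnS.
  + by split=> //=; rewrite /update /= ?subnn ?addn0.
  + by rewrite /= /wi; lra.
- by split=> //=; rewrite /update /= ?subnn.
- by rewrite /= /wi /w; lra.
Qed.

Lemma wp_foreach_pair (J : nat -> (nat -> nat) -> (nat -> nat -> R) -> R -> Prop)
    (c : cmd) (wb : R) im rm r : 0 <= wb ->
  (forall s a im rm r, sized im -> im 3%N 0%N = enum_rank s -> im 4%N 0%N = enum_rank a ->
     im 5%N 0%N = pair_index s a -> J (pair_index s a) (im 2%N) rm r ->
     wp c wb (fun im' rm' r' => J (pair_index s a).+1 (im' 2%N) rm' r' /\
        forall x, x != 2%N -> x != 6%N -> im' x = im x) im rm r) ->
  sized im -> J 0%N (im 2%N) rm r ->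
  wp (foreach_pair c) (len%:R * (wb + 100))
    (fun im' rm' r' => J len (im' 2%N) rm' r' /\ sized im') im rm r.
Proof.
move=> wb0 hc [s0 s1] J0; apply: wp_mono (wp_foreach S_gt0 A_gt0 wb0 _ s0 s1 J0) _ _ => //.
  move=> i j im1 rm1 r1 /rank_onto[s ->] /rank_onto[a ->] z0 z1; apply: hc; split=> //.
by move=> im1 rm1 r1 [].
Qed.

Section Estimate.
Variables (lam p L : R) (x : nat) (s : S) (a : A).
Variables (im : nat -> nat -> nat) (rm : nat -> nat -> R).
Hypothesis lam_ge0 : 0 <= lam.
Hypothesis p_ge0 : 0 <= p.
Hypothesis x_lt : (x < 12)%N.
Hypothesis im3 : im 3%N 0%N = enum_rank s.
Hypothesis im4 : im 4%N 0%N = enum_rank a.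

Let y (t : S) : R := rm x (enum_rank t).
Let k := rm 9%N 0%N.
Let n := rm 11%N 0%N.
Let mu := mean (trans M s a) y.
Let D := mean (trans M s a) (fun t => (y t - y s) ^+ 2).
Let Z (t : S) : R := y t - k * (y t - y s) ^+ 2.

Hypothesis k_gt0 : 0 < k.

Variable P : Prop.
Hypothesis P_bounded : P -> exists2 B : R, forall t, 0 <= y t <= B & k * B <= 1/4.

(* A supermartingale: Chernoff bounds for both tails of the sum of the
   samples. *)
Let potential (acc : R) (j : nat) : R := expR (- L) *
  (expR (k / 8 * (acc - j%:R * mu)) + expR (- (k / 8) * (acc - j%:R * (mu - 2 * k * D)))).

Let potential_step acc j : P ->
  \sum_t trans M s a t * potential (acc + Z t) j.+1 <= potential acc j.
Proof.
move=> /P_bounded[B yB kB].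
have h1 := mean_expR_upper (@trans_ge0 _ _ _ M s a) (trans_sum1 M s a) yB (yB s) k_gt0 kB.
have h2 := mean_expR_lower (@trans_ge0 _ _ _ M s a) (trans_sum1 M s a) yB (yB s) k_gt0 kB.
rewrite -/mu -/D in h1 h2.
set E1 := expR (k / 8 * (acc - j%:R * mu)).
set E2 := expR (- (k / 8) * (acc - j%:R * (mu - 2 * k * D))).
rewrite -/(mean (trans M s a) (fun t => potential (acc + Z t) j.+1)).
rewrite (@eq_mean _ _ _ _ (fun t => expR (- L) * (E1 * expR (k / 8 * (Z t - mu))
   + E2 * expR (- (k / 8) * (Z t - mu + 2 * k * D))))); last first.
  move=> t; rewrite /potential /E1 /E2 -!expRD -natr1; congr (_ * (expR _ + expR _)); ring.
rewrite meanZ meanD !meanZ /potential -/E1 -/E2 ler_wpM2l ?expR_ge0 // lerD //.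
  by rewrite ler_piMr ?expR_ge0.
by rewrite ler_piMr ?expR_ge0.
Qed.

(** Both exponentials of the potential start at 1, hence the price [2 * expR (- L)]. The range of
    [y] is known only under [P]; the length of the loop depends on [n] alone, so the time bound
    survives an earlier failure. *)
Lemma wp_estimate b r w : 0 < b -> 0 < L -> n * (k * b) = 8 * L ->
  budget lam (p + 2 * expR (- L)) P r ->
  (n + 2) * W <= w ->
  wp (estimate x) w (fun im' rm' r' =>
    [/\ forall i, i != 6%N -> im' i = im i,
        forall i, i != 12%N -> i != 13%N -> rm' i = rm i &
        budget lam p (P /\ mu - 2 * k * D - b <= rm' 12%N 0%N / rm' 13%N 0%N <= mu + b) r'])
    im rm r.
Proof.
move=> b_gt0 L_gt0 hn hr hw.
have a0 := fun x => @allocated0 x.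
have W0 := W_ge100.
have kb_gt0 : 0 < k * b by rewrite mulr_gt0.
have n_gt0 : 0 < n by rewrite -(pmulr_lgt0 _ kb_gt0) hn mulr_gt0.
pose N := (Num.truncn n).+1.
have nN : n <= N%:R by rewrite ltW // truncnS_gt.
have Nn : N%:R <= n + 1.
  by rewrite /N -natr1 lerD2r; have /andP[] := truncn_itv (ltW n_gt0).
pose I m : assertion R := fun im' rm' r' =>
  [/\ forall i, i != 6%N -> im' i = im i,
      forall i, i != 12%N -> i != 13%N -> rm' i = rm i &
      exists j : nat, [/\ rm' 13%N 0%N = j%:R, n <= (j + m)%:R &
        budget lam (p + potential (rm' 12%N 0%N) j) P r']].
have nW : (n + 1) * 100 <= (n + 1) * W by rewrite ler_pM2l // ltr_wpDr.
apply: (@wp_seq _ _ _ _ _ _ _ _ _ 3 (w - 4)); last by lra.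
apply: wp_straight => /=; last (by rewrite ler_nat); split=> //; first by apply: a0.
apply: (@wp_seq _ _ _ _ _ _ _ _ _ 3 (w - 8)); last by lra.
apply: wp_straight => /=; last (by rewrite ler_nat); split=> //; first by apply: a0.
apply: (@wp_while _ _ _ _ _ _ _ I _ _ (W - 20) _ _ _ N).
- by lra.
- move=> m im1 rm1 r1 [fi fr [j [rj nj Ir]]] /=.
  split; first by do !split=> //; apply: a0.
  rewrite (fr 11%N) // -/n rj; case: ltrP => jn; last first.
    split=> //; case: Ir => [|[Ir hP]]; [by left|].
    have j_gt0 : 0 < j%:R :> R by apply: lt_le_trans jn.
    (* By the choice of [n], a deviation of the average by [b] brings an exponent up to [L]. *)
    have Lj : L <= (k / 8) * (b * j%:R).
      have : n * (k * b) <= j%:R * (k * b) by rewrite ler_pM2r.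
      by rewrite hn; lra.
    set acc := rm1 12%N 0%N in Ir *.
    (* An exponent that reaches [L] cancels the factor [expR (- L)]: the potential is at least 1, so
       the budget pays for the failure. *)
    have dead q q' : L <= q -> potential acc j = expR (- L) * (expR q + expR q') ->
      lam <= r1.
      move=> Lq pE; apply: le_trans Ir; rewrite ler_peMr // pE.
      have : 1 <= expR (- L) * expR q by rewrite -expRD -[leLHS]expR0 ler_expR; lra.
      have : 0 <= expR (- L) * expR q' by rewrite mulr_ge0 ?expR_ge0.
      by rewrite mulrDr; have := p_ge0; lra.
    have k8 : 0 < k / 8 by rewrite divr_gt0.
    case: (lerP L (k / 8 * (acc - j%:R * mu))) => [h|/lt_le_trans/(_ Lj)].
      by left; apply: dead h _.
    rewrite ltr_pM2l // => up.
    case: (lerP L (- (k / 8) * (acc - j%:R * (mu - 2 * k * D)))) => [h|/lt_le_trans/(_ Lj)].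
      by left; apply: dead h _; rewrite /potential addrC.
    rewrite mulNr -mulrN ltr_pM2l // => low; right; split.
      by apply: le_trans Ir; rewrite ler_wpM2l // lerDl mulr_ge0 ?addr_ge0 ?expR_ge0 //.
    split=> //; rewrite ler_pdivrMr // ler_pdivlMr //.
    by apply/andP; split; move: up low; lra.
  have m_gt0 : (0 < m)%N.
    by case: m nj => //; rewrite addn0 leNgt jn.
  split; first exact: m_gt0.
  apply: wp_straight_const; last exact: lexx; last first.
    by clear; rewrite /=; lia.
  rewrite /=.
  have im1_3 : im1 3%N 0%N = enum_rank s by rewrite fi.
  have im1_4 : im1 4%N 0%N = enum_rank a by rewrite fi.
  have rx i : rm1 x i = rm x i by rewrite fr // neq_ltn (leq_trans x_lt).
  have r9 : rm1 9%N 0%N = k by rewrite fr.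
  have x16 : (x < 16)%N by apply: leq_trans x_lt _.
  split=> //; try exact: a0; try (by split=> //; exact: a0).
  exists s, a; split=> //.
  (* A path without failure gives each answer the potential it leads to; a path already paid for
     keeps its budget unchanged. *)
  have [rs [rs_sum hrs]] : exists rs : S -> R, \sum_t trans M s a t * rs t <= r1 /\
      forall t, budget lam (p + potential (rm1 12%N 0%N + Z t) j.+1) P (rs t).
    case: Ir => [lr|[Ir hb]].
      exists (fun=> r1); split; last by left.
      by rewrite -/(mean (trans M s a) (fun=> r1)) mean_cst //; exact: trans_sum1.
    exists (fun t => lam * (p + potential (rm1 12%N 0%N + Z t) j.+1)); split; last by right.
    apply: le_trans Ir; rewrite -/(mean (trans M s a) (fun t =>
      lam * _)) meanZ meanD mean_cst; last exact: trans_sum1.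
    by rewrite ler_wpM2l // lerD2l; apply: potential_step.
  exists rs; split=> // t /=; rewrite /update /= im1_3.
  have as_t := @allocated_state x s x16; have at_t := @allocated_state x t x16.
  do !split=> //; try exact: a0.
  - by move=> i i6; apply/funext => l; rewrite (negPf i6) /= fi.
  - by move=> i i12 i13; apply/funext => l; rewrite (negPf i12) (negPf i13) /= fr.
  exists j.+1; split.
  - by rewrite rj natr1.
  - by rewrite addSn -addnS prednK.
  - by rewrite /= !rx r9; have := hrs t; rewrite /Z expr2.
- split; [by []| |exists 0%N; split; rewrite ?add0n //].
    by move=> i i12 i13; apply/funext => l; rewrite /update (negPf i12) (negPf i13).
  rewrite /update /= /potential !mul0r subr0 !mulr0 expR0.
  by move: hr; rewrite mulrC.
- apply: (@le_trans _ _ ((n + 1) * (W - 14) + 6)); last by rewrite /=; lra.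
  by rewrite /= lerD2r; apply: ler_pM => //; lra.
Qed.

End Estimate.
End Program.

(** * Code of an epoch *)

Definition gap : rexp := RSub (RConst 1) (rvar 1).
Definition estimated : rexp := RSub (RDiv (rvar 12) (rvar 13)) (rvar 10).
Definition value_cell : rexp := RAdd (RCell 4 (ivar 3)) (RCell 5 (ivar 3)).

Definition coarse_body : cmd := Seq (estimate 4) (RAssign 6 (ivar 5) estimated).

(** The update is in place: later pairs of the same sweep already see the larger value. *)
Definition fine_update : cmd :=
  Seq (rset 15 (RAdd (RCell 0 (ivar 5))
                     (RMul (rvar 1) (RAdd (RCell 6 (ivar 5)) estimated))))
  (If (BRLt value_cell (rvar 15))
      (Seq (RAssign 5 (ivar 3) (RSub (rvar 15) (RCell 4 (ivar 3))))
           (IAssign 2 (ivar 3) (ivar 4)))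
      Skip).

Definition fine_body : cmd := Seq (estimate 5) fine_update.

(** Executed once per action of a state; after the first time the increment is 0, so the repetitions
    are harmless. *)
Definition merge_body : cmd :=
  Seq (RAssign 4 (ivar 3) value_cell) (RAssign 5 (ivar 3) (RConst 0)).

Definition sample_size : rexp :=
  RDiv (RMul (RConst 8) (rvar 7)) (RMul (rvar 9) (rvar 10)).

Definition coarse_setup : cmd :=
  Seq (rset 9 (RDiv (RMul (RMul gap gap) (rvar 2)) (RConst 128)))
  (Seq (rset 10 (RDiv (RMul gap (rvar 2)) (RConst 64)))
       (rset 11 sample_size)).

Definition fine_setup : cmd :=
  Seq (rset 9 (RDiv gap (RMul (RConst 64) (rvar 8))))
  (Seq (rset 10 (RDiv (RMul gap (rvar 8)) (RConst 64)))
  (Seq (rset 11 sample_size) (rset 14 (RConst 0)))).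

Definition sweeps : cmd :=
  While (BRLt (rvar 14) (RDiv (RConst 3) gap))
    (Seq (foreach_pair fine_body) (rset 14 (RAdd (rvar 14) (RConst 1)))).

Definition epoch : cmd :=
  Seq coarse_setup (Seq (foreach_pair coarse_body)
  (Seq fine_setup (Seq sweeps
  (Seq (foreach_pair merge_body) (rset 8 (RDiv (rvar 8) (RConst 2))))))).

Ltac safety := repeat match goal with
  | |- _ /\ _ => split
  | |- True => exact: I end.

(** * Correctness and cost of the passes of an epoch *)

Section Passes.
Context (R : realType) (S A : finType) (M : dmdp R S A) (tau : nat).
Hypothesis S_gt0 : (0 < #|S|)%N.
Hypothesis A_gt0 : (0 < #|A|)%N.
Variables (eps lam L : R).
Hypothesis eps_itv : 0 < eps < 1.
Hypothesis lam_ge0 : 0 <= lam.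
Hypothesis L_gt0 : 0 < L.

Let len := (#|S| * #|A|)%N.
Let wp := wp M 16 len tau.
Let W : R := (100 + tau)%:R.
Let V := optimal_value M.
Let eta := 2 * expR (- L).
Let W_ge100 : 100 <= W. Proof. by rewrite /W ler_nat leq_addr. Qed.
Let eta_ge0 : 0 <= eta. Proof. by rewrite mulr_ge0 ?expR_ge0. Qed.

Definition setting (u : R) (rm : nat -> nat -> R) : Prop :=
  [/\ forall s a, rm 0%N (pair_index s a) = reward M s a,
      rm 1%N 0%N = discount M, rm 2%N 0%N = eps, rm 7%N 0%N = L & rm 8%N 0%N = u].

Definition sampling (k b : R) (rm : nat -> nat -> R) : Prop :=
  [/\ rm 9%N 0%N = k, rm 10%N 0%N = b & rm 11%N 0%N * (k * b) = 8 * L].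

Lemma setting_frame u rm rm' : (forall i, i != 12%N -> i != 13%N -> rm' i = rm i) ->
  setting u rm -> setting u rm'.
Proof. by move=> fr [h1 h2 h3 h4 h5]; split=> [s a||||]; rewrite fr. Qed.

Lemma sampling_frame k b rm rm' : (forall i, i != 12%N -> i != 13%N -> rm' i = rm i) ->
  sampling k b rm -> sampling k b rm'.
Proof. by move=> fr [h1 h2 h3]; split; rewrite !fr. Qed.

Definition value (v0 d : nat -> R) : {ffun S -> R} :=
  [ffun s => v0 (enum_rank s) + d (enum_rank s)].

Definition sound (pol : nat -> nat) (v : {ffun S -> R}) : Prop :=
  exists2 pi : S -> A, forall s, pol (enum_rank s) = enum_rank (pi s) &
    forall s, v s <= backup M v s (pi s).

Definition close (u : R) (v0 : nat -> R) : Prop :=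
  forall s : S, 0 <= v0 (enum_rank s) /\ V s - v0 (enum_rank s) <= u.

Definition coarse_ok (v0 w : nat -> R) (s : S) (a : A) : Prop :=
  let m := mean (trans M s a) (fun t => v0 (enum_rank t)) in
  m - 2 * coarse_scale M eps *
        mean (trans M s a) (fun t => (v0 (enum_rank t) - v0 (enum_rank s)) ^+ 2)
    - 2 * coarse_margin M eps <= w (pair_index s a) <= m.

Lemma pair_index_inj (s s' : S) (a a' : A) : pair_index s a = pair_index s' a' ->
  s = s' /\ a = a'.
Proof.
rewrite /pair_index => h; have ha := ltn_ord (enum_rank a);
  have ha' := ltn_ord (enum_rank a').
have es : enum_rank s = enum_rank s' :> nat.
  by have := congr1 (divn^~ #|A|) h; rewrite !divnMDl // !divn_small // !addn0.
have ea : enum_rank a = enum_rank a' :> nat by move: h; rewrite es => /addnI.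
by split; apply: enum_rank_inj; apply: val_inj.
Qed.

Lemma sound_le pol v s : sound pol v -> v s <= V s.
Proof.
by case=> pi _ /(policy_value_between A_gt0) /(_ s) /andP[]; apply: le_trans.
Qed.

Section Epoch.
Variable u : R.
Hypothesis u_itv : eps < u <= (1 - discount M)^-1.

Let k1 := coarse_scale M eps.
Let b1 := coarse_margin M eps.
Let k2 := fine_scale M u.
Let b2 := fine_margin M u.
Let n1 := 8 * L / (k1 * b1).
Let n2 := 8 * L / (k2 * b2).
Let k1_gt0 : 0 < k1. Proof. exact: coarse_scale_gt0. Qed.
Let b1_gt0 : 0 < b1. Proof. exact: coarse_margin_gt0. Qed.
Let k2_gt0 : 0 < k2. Proof. exact: fine_scale_gt0 u_itv. Qed.
Let b2_gt0 : 0 < b2. Proof. exact: fine_margin_gt0 u_itv. Qed.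
Let n1_gt0 : 0 < n1. Proof. by apply: divr_gt0; apply: mulr_gt0. Qed.
Let n2_gt0 : 0 < n2. Proof. by apply: divr_gt0; apply: mulr_gt0. Qed.

(** [setting] and [sampling] stand outside the budget: they determine the loop lengths and must
    survive a failure. Each pair still to be visited reserves [eta]. *)
Definition coarse_inv (p : R) (m : nat) (pol : nat -> nat) (rm : nat -> nat -> R) (r :
  R) : Prop :=
  [/\ setting u rm, sampling k1 b1 rm &
    budget lam (p + (len - m)%:R * eta)
      [/\ close u (rm 4%N), forall s : S, rm 5%N (enum_rank s) = 0,
          sound pol (value (rm 4%N) (rm 5%N)) &
          forall s a, (pair_index s a < m)%N -> coarse_ok (rm 4%N) (rm 6%N) s a] r].

Lemma wp_coarse_pass (p : R) im rm r w : 0 <= p -> sized S A im ->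
  coarse_inv p 0 (im 2%N) rm r -> len%:R * ((n1 + 3) * W + 100) <= w ->
  wp (foreach_pair coarse_body) w
    (fun im rm r => coarse_inv p len (im 2%N) rm r /\ sized S A im) im rm r.
Proof.
move=> p_ge0 sz h0 hw; have W0 := W_ge100.
have wb0 : 0 <= (n1 + 3) * W by apply: mulr_ge0; move: n1_gt0 W0; lra.
have a0 := fun x => @allocated0 S A S_gt0 A_gt0 x.
apply: wp_mono (wp_foreach_pair S_gt0 A_gt0 wb0 _ sz h0) hw _ => //.
move=> s a {im rm r sz h0} im rm r sz i3 i4 i5 [hset hsam hr].
have [r9 r10 r11] := hsam.
have ap := pair_index_lt s a.
apply: (@wp_seq _ _ _ _ _ _ _ _ _ ((n1 + 2) * W) (W - 20)); last by lra.
have n1E : rm 11%N 0%N = n1 by rewrite /n1 -r11 mulfK // mulf_neq0 ?lt0r_neq0.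
pose P := [/\ close u (rm 4%N), forall s : S, rm 5%N (enum_rank s) = 0,
          sound (im 2%N) (value (rm 4%N) (rm 5%N)) &
          forall s' a', (pair_index s' a' < pair_index s a)%N ->
            coarse_ok (rm 4%N) (rm 6%N) s' a'].
have hq : 0 <= p + (len - (pair_index s a).+1)%:R * eta by apply: addr_ge0 => //;
  apply: mulr_ge0.
have hb : P -> exists2 B : R, forall t :
  S, 0 <= rm 4%N (enum_rank t) <= B & rm 9%N 0%N * B <= 1/4.
  rewrite /P => -[hc hd hs _]; exists (1 - discount M)^-1; last by rewrite r9;
    exact: coarse_scale_bound.
  move=> t; have [-> _] := hc t; have := sound_le t hs;
    rewrite ffunE hd addr0 => /le_trans -> //.
  by have /andP[] := optimal_value_itv M A_gt0 t.
have hr' : budget lam (p + (len - (pair_index s a).+1)%:R * eta + 2 * expR (- L)) P r.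
  case: hr => [|[hr hP]]; [by left|right; split=> //].
  apply: le_trans hr; rewrite ler_wpM2l // -addrA lerD2l -/eta -[X in _ + X]mul1r -mulrDl
    natr1.
  by rewrite -(@subnSK (pair_index s a)).
have k_gt0 : 0 < rm 9%N 0%N by rewrite r9.
have hn : rm 11%N 0%N * (rm 9%N 0%N * b1) = 8 * L by rewrite r9.
have he := wp_estimate (M := M) (tau := tau) (x :=
  4%N) S_gt0 A_gt0 lam_ge0 hq isT i3 i4 k_gt0 hb b1_gt0 L_gt0 hn hr' (lexx _).
rewrite n1E in he; apply: (wp_mono he (lexx _)) => {he}.
move=> im1 rm1 r1 [fi fr hr1].
have set1 := setting_frame fr hset; have sam1 := sampling_frame fr hsam.
have i5' : im1 5%N 0%N = pair_index s a by rewrite fi.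
apply: wp_straight_const; [|by clear; rewrite /=; lia|exact: lexx].
have x4 := fr 4%N isT isT; have x5 := fr 5%N isT isT; have x6 := fr 6%N isT isT.
have im2E : im1 2%N = im 2%N by rewrite fi.
rewrite /= i5'; split=> //.
- by safety; apply: a0.
- by safety; apply: a0.
split; last by move=> x _ x6'; rewrite fi.
split; [exact: set1|exact: sam1|].
case: hr1 => [|[hr1 [hP hest]]]; [by left|right; split=> //].
move: hP; rewrite /P -x4 -x5 -x6 -im2E => -[hc hd hs hw'].
split=> // s' a'; rewrite ltnS leq_eqVlt => /orP[/eqP/pair_index_inj[-> ->]|hlt].
  rewrite /coarse_ok /update /= eqxx.
  move: hest; rewrite r9 -x4; have [_ -> _] := sam1.
  by move=> /andP[h1 h2]; apply/andP; split; move: h1 h2; rewrite -/k1 -/b1; lra.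
have := hw' s' a' hlt; rewrite /coarse_ok /update /=.
by rewrite (ltn_eqF hlt).
Qed.

Definition fine_state (i : nat) (pol : nat -> nat) (v0 d w : nat -> R) : Prop :=
  [/\ close u v0, forall s : S, 0 <= d (enum_rank s), sound pol (value v0 d),
      forall s a, coarse_ok v0 w s a &
      forall s, V s - value v0 d s <= sweep_error M eps u i s].

(** The error recursion follows a greedy policy for the optimal value, so only greedy actions are
    tracked; a full pass visits one at each state. *)
Definition swept (i m : nat) (v : S -> R) : Prop :=
  forall s a, (pair_index s a < m)%N -> V s = backup M V s a ->
    V s - v s <= sweep_error M eps u i.+1 s.

Lemma swept_mono i m (v v' : S -> R) : (forall s, v s <= v' s) -> swept i m v ->
  swept i m v'.
Proof. by move=> vv' h s a hs hV; have := h s a hs hV; have := vv' s; lra. Qed.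

Lemma swept_next i (v : S -> R) s a : swept i (pair_index s a) v ->
  (V s = backup M V s a -> V s - v s <= sweep_error M eps u i.+1 s) ->
  swept i (pair_index s a).+1 v.
Proof.
move=> h hs s' a'; rewrite ltnS leq_eqVlt => /orP[/eqP/pair_index_inj[-> ->]|];
  first exact: hs.
exact: h.
Qed.

(** The new value at [s] is at most the backup of the old values, and values only increase. By
    monotonicity of the backup, soundness persists at all states, even in the middle of a sweep. *)
Lemma fine_state_improve i (pol pol' : nat -> nat) (v0 d d' w : nat -> R) s a q :
  fine_state i pol v0 d w ->
  value v0 d s < q -> q <= backup M (value v0 d) s a ->
  (forall t, pol' (enum_rank t) = if t == s then enum_rank a :
    nat else pol (enum_rank t)) ->
  (forall t, d' (enum_rank t) = if t == s then q - v0 (enum_rank s) else d (enum_rank t)) ->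
  fine_state i pol' v0 d' w /\ forall t, value v0 d t <= value v0 d' t.
Proof.
move=> [hc hd [pi hpi hv] hw hE] lt_q le_q hpol hd'.
have le_v t : value v0 d t <= value v0 d' t.
  rewrite !ffunE hd'; case: eqP => // ->.
  by move: lt_q; rewrite ffunE; lra.
split=> //; split=> //.
- move=> t; rewrite hd'; case: eqP => // _.
  by have := hd s; move: lt_q; rewrite ffunE; lra.
- exists (fun t => if t == s then a else pi t) => t.
    by rewrite hpol; case: eqP.
  apply: (@le_trans _ _ (backup M (value v0 d) t (if t == s then a else pi t)));
    last exact: backup_mono.
  case: (t =P s) => [->|ts]; last by have := hv t; rewrite !ffunE hd'; case: eqP.
  by rewrite ffunE hd' eqxx addrC subrK.
- by move=> t; apply: le_trans (hE t); have := le_v t; lra.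
Qed.

(** [v0 + d <= V] by soundness and [V <= v0 + u] by closeness. This is the range for which the fine
    scale is chosen. *)
Lemma fine_state_itv i pol v0 d w : fine_state i pol v0 d w ->
  forall s : S, 0 <= d (enum_rank s) <= u.
Proof.
move=> [hc hd hs _ _] s; rewrite hd /=.
by have := sound_le s hs; have [_] := hc s; rewrite ffunE; lra.
Qed.

(* [q] is the candidate value of the pair [(s, a)] and [x] the estimated mean
   of [d], whose one-sided error is absorbed by the margin. *)
Lemma fine_candidate i pol v0 d w s a x q : fine_state i pol v0 d w ->
  let md := mean (trans M s a) (fun t => d (enum_rank t)) in
  md - 2 * k2 * mean (trans M s a) (fun t => (d (enum_rank t) - d (enum_rank s)) ^+ 2) - b2
    <= x <= md + b2 ->
  q = reward M s a + discount M * (w (pair_index s a) + (x - b2)) ->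
  q <= backup M (value v0 d) s a /\
  (V s = backup M V s a -> V s - q <= sweep_error M eps u i.+1 s).
Proof.
move=> st md /andP[xl xu] ->; have [hc hd hs hw hE] := st.
have /andP[d0 d1] := discount_itv M.
have /andP[wl wu] := hw s a.
have mE : mean (trans M s a) (value v0 d) = mean (trans M s a) (fun t =>
  v0 (enum_rank t)) + md.
  by rewrite -meanD; apply: eq_mean => t; rewrite ffunE.
split.
  by rewrite backupE lerD2l ler_pM2l // mE; move: wu xu; lra.
move=> hV; apply: (sweep_error_step A_gt0 eps_itv u_itv (v0 := fun t =>
  v0 (enum_rank t)) (v := value v0 d) hV).
- move=> t; have [_ -> ] := hc t; rewrite andbT.
  by have := sound_le t hs; have := hd t; rewrite ffunE; lra.
- by move=> t; rewrite ffunE addrC addKr; exact: fine_state_itv st t.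
- exact: hE.
rewrite lerD2l ler_pM2l // mE.
rewrite (@eq_mean _ _ _ (fun t =>
  (value v0 d t - v0 (enum_rank t) - (value v0 d s - v0 (enum_rank s))) ^+ 2)
  (fun t => (d (enum_rank t) - d (enum_rank s)) ^+ 2)); last first.
  by move=> t; rewrite !ffunE; congr (_ ^+ 2); ring.
by move: wl xl; rewrite -/k1 -/b1 -/k2 -/b2; lra.
Qed.

Definition fine_inv (i : nat) (p : R) (m : nat) (pol : nat -> nat) (rm : nat -> nat ->
  R) (r : R) : Prop :=
  [/\ setting u rm, sampling k2 b2 rm, rm 14%N 0%N = i%:R &
    budget lam (p + (len - m)%:R * eta)
      (fine_state i pol (rm 4%N) (rm 5%N) (rm 6%N) /\
        swept i m (value (rm 4%N) (rm 5%N))) r].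

Lemma wp_fine_pass i (p : R) im rm r w : 0 <= p -> sized S A im ->
  fine_inv i p 0 (im 2%N) rm r -> len%:R * ((n2 + 3) * W + 100) <= w ->
  wp (foreach_pair fine_body) w
    (fun im rm r => fine_inv i p len (im 2%N) rm r /\ sized S A im) im rm r.
Proof.
move=> p_ge0 sz h0 hw; have W0 := W_ge100.
have wb0 : 0 <= (n2 + 3) * W by apply: mulr_ge0; move: n2_gt0 W0; lra.
have a0 := fun x => @allocated0 S A S_gt0 A_gt0 x.
apply: wp_mono (wp_foreach_pair S_gt0 A_gt0 wb0 _ sz h0) hw _ => //.
move=> s a {im rm r sz h0} im rm r sz i3 i4 i5 [hset hsam h14 hr].
have [r9 r10 r11] := hsam.
have ap := pair_index_lt s a.
apply: (@wp_seq _ _ _ _ _ _ _ _ _ ((n2 + 2) * W) (W - 20)); last by lra.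
have n2E : rm 11%N 0%N = n2 by rewrite /n2 -r11 mulfK // mulf_neq0 ?lt0r_neq0.
set P := (_ /\ _) in hr.
have hq : 0 <= p + (len - (pair_index s a).+1)%:R * eta by apply: addr_ge0 => //;
  apply: mulr_ge0.
have hb : P -> exists2 B : R, forall t :
  S, 0 <= rm 5%N (enum_rank t) <= B & rm 9%N 0%N * B <= 1/4.
  case=> st _; exists u; last by rewrite r9; exact: (fine_scale_bound eps_itv).
  exact: fine_state_itv st.
have hr' : budget lam (p + (len - (pair_index s a).+1)%:R * eta + 2 * expR (- L)) P r.
  case: hr => [|[hr hP]]; [by left|right; split=> //].
  apply: le_trans hr; rewrite ler_wpM2l // -addrA lerD2l -/eta -[X in _ + X]mul1r -mulrDl
    natr1.
  by rewrite -(@subnSK (pair_index s a)).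
have k_gt0 : 0 < rm 9%N 0%N by rewrite r9.
have hn : rm 11%N 0%N * (rm 9%N 0%N * b2) = 8 * L by rewrite r9.
have he := wp_estimate (M := M) (tau := tau) (x :=
  5%N) S_gt0 A_gt0 lam_ge0 hq isT i3 i4 k_gt0 hb b2_gt0 L_gt0 hn hr' (lexx _).
rewrite n2E in he; apply: (wp_mono he (lexx _)) => {he}.
move=> im1 rm1 r1 [fi fr hr1].
have set1 := setting_frame fr hset; have sam1 := sampling_frame fr hsam.
have f14 : rm1 14%N 0%N = i%:R by rewrite fr.
have i5' : im1 5%N 0%N = pair_index s a by rewrite fi.
have i3' : im1 3%N 0%N = enum_rank s by rewrite fi.
have i4' : im1 4%N 0%N = enum_rank a by rewrite fi.
apply: wp_straight_const; [|by clear; rewrite /=; lia|exact: lexx].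
have x4 := fr 4%N isT isT; have x5 := fr 5%N isT isT; have x6 := fr 6%N isT isT.
have im2E : im1 2%N = im 2%N by rewrite fi.
have as_ x : (x < 16)%N -> allocated 16 len x (enum_rank s) by exact: allocated_state.
have ap_ x : (x < 16)%N -> allocated 16 len x (pair_index s a) by exact: allocated_pair.
rewrite /= i5' i3' i4'; split; first by [].
- by safety; (apply: a0 || apply: ap_).
- exact: a0.
split; first by safety; (apply: a0 || apply: as_).
have [rew rdisc _ _ _] := set1; have [_ r10' _] := sam1.
set q := rm1 0%N (pair_index s a) + _.
have hfr x : x != 2%N -> x != 6%N -> im1 x = im x by move=> _; apply: fi.
have hcand : P -> mean (trans M s a) (fun t => rm 5%N (enum_rank t)) -
    2 * k2 * mean (trans M s a) (fun t =>
      (rm 5%N (enum_rank t) - rm 5%N (enum_rank s)) ^+ 2) - b2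
    <= rm1 12%N 0%N / rm1 13%N 0%N <= mean (trans M s a) (fun t =>
      rm 5%N (enum_rank t)) + b2 ->
    q <= backup M (value (rm 4%N) (rm 5%N)) s a /\
    (V s = backup M V s a -> V s - q <= sweep_error M eps u i.+1 s).
  move=> [st _] hx; apply: (fine_candidate st hx).
  by rewrite /q rew rdisc r10' x6.
rewrite r9 in hr1.
have -> : (update rm1 15 0 q 4%N (enum_rank s) + update rm1 15 0 q 5%N (enum_rank s)
    < update rm1 15 0 q 15%N 0%N) = (value (rm 4%N) (rm 5%N) s < q).
  by rewrite /update /= ffunE x4 x5.
(* A candidate that is not larger than the current value passes its error bound on to it. *)
case: ltrP => hlt; last first.
  split=> //; split; [exact: set1|exact: sam1|exact: f14|].
  case: hr1 => [|[hr1 [hP hest]]]; [by left|right; split=> //].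
  have [_ hlow] := hcand hP hest; move: hP => [st hsw].
  rewrite im2E /update /= x4 x5 x6; split=> //; apply: swept_next hsw _ => /hlow.
  by apply: le_trans; rewrite lerD2l lerN2.
split; [by safety; apply: a0|by safety; (apply: a0 || apply: as_)|exact: as_|].
split; [by safety; apply: a0|by safety; apply: a0|exact: as_|].
split; last first.
  by move=> x x2 x6'; apply/funext => l; rewrite /update (negPf x2) /= fi.
split; [exact: set1|exact: sam1|exact: f14|].
case: hr1 => [|[hr1 [hP hest]]]; [by left|right; split=> //].
have [hup hlow] := hcand hP hest; move: hP => [st hsw].
rewrite /update /= im2E x4 x5 x6.
have rank_eq (t : S) : (enum_rank t == enum_rank s :> nat) = (t == s).
  by rewrite val_eqE (inj_eq enum_rank_inj).
set pol' := (fun j => if j == _ then enum_rank a : nat else _).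
set d' := (fun j => if j == _ then q - _ else _).
have [st' hv] : fine_state i pol' (rm 4%N) d' (rm 6%N) /\
  forall t, value (rm 4%N) (rm 5%N) t <= value (rm 4%N) d' t.
  by apply: (fine_state_improve st hlt hup) => t; rewrite /pol' /d' rank_eq.
split=> //; apply: swept_next; first exact: swept_mono hv hsw.
move=> /hlow; apply: le_trans; rewrite lerD2l lerN2.
by rewrite ffunE /d' eqxx addrC subrK.
Qed.

Lemma wp_sweeps (p : R) (I : nat) im rm r w : 0 <= p -> sized S A im ->
  setting u rm -> sampling k2 b2 rm -> rm 14%N 0%N = 0 ->
  3 / (1 - discount M) <= I%:R ->
  budget lam (p + I%:R * (len%:R * eta)) (fine_state 0 (im 2%N) (rm 4%N) (rm 5%N) (rm
    6%N)) r ->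
  I%:R * (len%:R * ((n2 + 3) * W + 100) + 30) + 20 <= w ->
  wp sweeps w (fun im rm r => [/\ sized S A im, setting u rm &
    budget lam p (exists2 i : nat, 3 / (1 - discount M) <= i%:R &
                    fine_state i (im 2%N) (rm 4%N) (rm 5%N) (rm 6%N)) r]) im rm r.
Proof.
move=> p_ge0 sz hset hsam h14 hI hr hw; have W0 := W_ge100.
have a0 := fun x => @allocated0 S A S_gt0 A_gt0 x.
have le_eta : 0 <= len%:R * eta by apply: mulr_ge0.
set wp1 := len%:R * _ in hw.
have wp1_ge0 : 0 <= wp1.
  by apply: mulr_ge0 => //; apply: addr_ge0 => //; apply: mulr_ge0; move: n2_gt0 W0; lra.
pose J n : assertion R := fun im rm r => [/\ sized S A im, setting u rm, sampling k2 b2 rm &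
  exists i : nat, [/\ rm 14%N 0%N = i%:R, 3 / (1 - discount M) <= (i + n)%:R &
    budget lam (p + n%:R * (len%:R * eta)) (fine_state i (im 2%N) (rm 4%N) (rm 5%N) (rm
      6%N)) r]].
apply: (@wp_while _ _ _ _ _ _ _ J _ _ (wp1 + 15) _ _ _ I).
- by lra.
- move=> n {im rm r sz hset hsam h14 hr} im rm r [sz hset hsam [i [ri hi hr]]].
  split; first by rewrite /=; safety; apply: a0.
  have [_ rdisc _ _ _] := hset.
  rewrite /= ri rdisc; case: ltrP => hlt; last first.
    split=> //; case: hr => [|[hr hst]]; [by left|right]; split; last by exists i.
    by apply: le_trans hr; rewrite ler_wpM2l // lerDl mulr_ge0.
  have n_gt0 : (0 < n)%N.
    by rewrite lt0n; apply/eqP => n0; move: hi; rewrite n0 addn0 leNgt hlt.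
  split; first exact: n_gt0.
  pose p' := p + n.-1%:R * (len%:R * eta).
  have p'_ge0 : 0 <= p' by apply: addr_ge0 => //; apply: mulr_ge0.
  have h0 : fine_inv i p' 0 (im 2%N) rm r.
    split; [exact: hset|exact: hsam|exact: ri|].
    case: hr => [|[hr hst]]; [by left|right; split=> //].
    suff -> : p' + (len - 0)%:R * eta = p + n%:R * (len%:R * eta) by [].
    by rewrite /p' subn0 -[in RHS](prednK n_gt0) -natr1; ring.
  apply: (@wp_seq _ _ _ _ _ _ _ _ _ wp1 10); last by lra.
  apply: wp_mono (wp_fine_pass p'_ge0 sz h0 (lexx _)) (lexx _) _.
  move=> im1 rm1 r1 [[hset1 hsam1 h14 hr1] sz1].
  apply: wp_straight; last by rewrite ler_nat.
  split; [by []|by rewrite /=; safety; apply: a0|exact: a0|].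
  split; [exact: sz1|exact: hset1|exact: hsam1|].
  exists i.+1; split.
  + by rewrite /= /update /= h14 natr1.
  + by rewrite addSn -addnS prednK.
  rewrite subnn mul0r addr0 in hr1.
  case: hr1 => [|[hr1 [[hc hd hs hk hE] hsw]]]; [by left|right; split=> //].
  split=> // s; have [a hV] := optimal_value_greedy M A_gt0 s.
  by apply: hsw hV; exact: pair_index_lt.
- by split=> //; exists 0%N; split.
- by rewrite /=; have := ler0n R I; lra.
Qed.

Definition epoch_inv (x p : R) : assertion R := fun im rm r =>
  [/\ sized S A im, setting x rm &
    budget lam p [/\ close x (rm 4%N), forall s : S, rm 5%N (enum_rank s) = 0 &
                     sound (im 2%N) (value (rm 4%N) (rm 5%N))] r].

Definition merge_inv (p : R) (m : nat) (pol : nat -> nat) (rm : nat -> nat -> R) (r :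
  R) : Prop :=
  setting u rm /\ budget lam p
    [/\ forall s : S, 0 <= rm 4%N (enum_rank s) /\ 0 <= rm 5%N (enum_rank s),
        sound pol (value (rm 4%N) (rm 5%N)),
        forall s, V s - value (rm 4%N) (rm 5%N) s <= u / 2 &
        forall (s : S) (a : A), (pair_index s a < m)%N -> rm 5%N (enum_rank s) = 0] r.

Lemma wp_merge_pass (p : R) im rm r w : sized S A im ->
  merge_inv p 0 (im 2%N) rm r -> len%:R * (W + 100) <= w ->
  wp (foreach_pair merge_body) w
    (fun im rm r => merge_inv p len (im 2%N) rm r /\ sized S A im) im rm r.
Proof.
move=> sz h0 hw; have W0 := W_ge100.
have a0 := fun x => @allocated0 S A S_gt0 A_gt0 x.
have wb0 : 0 <= W by lra.
apply: wp_mono (wp_foreach_pair S_gt0 A_gt0 wb0 _ sz h0) hw _ => //.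
move=> s a {im rm r sz h0} im rm r sz i3 i4 i5 [hset hr].
have as_ x : (x < 16)%N -> allocated 16 len x (enum_rank s) by exact: allocated_state.
apply: wp_straight_const; [|by clear; rewrite /=; lia|by lra].
rewrite /= i3; split; [by safety; apply: a0|by safety;
  (apply: a0 || apply: as_)|exact: as_|].
split; [by safety; apply: a0|by []|exact: as_|].
split; last by [].
split; first exact: hset.
case: hr => [|[hr [hnn hs hE hz]]]; [by left|right; split=> //].
rewrite /update /=.
have rank_eq (t : S) : (enum_rank t == enum_rank s :> nat) = (t == s).
  by rewrite val_eqE (inj_eq enum_rank_inj).
set v0' := (fun j => if j == _ then _ + _ else _).
set d' := (fun j => if j == _ then 0 else _).
have vE : value v0' d' = value (rm 4%N) (rm 5%N).
  apply/ffunP => t; rewrite !ffunE /v0' /d' rank_eq; case: eqP => // ->.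
  by rewrite addr0.
rewrite vE; split=> //.
- move=> t; have [h1 h2] := hnn t; rewrite /v0' /d' rank_eq; case: eqP => // ts.
  by rewrite -ts; split=> //; apply: addr_ge0.
- move=> s' a'; rewrite /d' rank_eq ltnS leq_eqVlt => /orP[/eqP/pair_index_inj[-> _]|].
    by rewrite eqxx.
  by case: eqP => // _ /hz.
Qed.

(** The factor [I.+1] counts one coarse pass and at most [I] sweeps, each charged [eta] per pair;
    merging draws no sample. *)
Lemma wp_epoch (p : R) (I : nat) im rm r w : 0 <= p ->
  3 / (1 - discount M) <= I%:R ->
  epoch_inv u (p + I.+1%:R * (len%:R * eta)) im rm r ->
  len%:R * ((n1 + 3) * W + 100) + I%:R * (len%:R * ((n2 + 3) * W + 100) + 30)
    + len%:R * (W + 100) + 3 * W <= w ->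
  wp epoch w (epoch_inv (u / 2) p) im rm r.
Proof.
move=> p_ge0 hI [sz hset hr] hw; have W0 := W_ge100.
have a0 := fun x => @allocated0 S A S_gt0 A_gt0 x.
have le_eta : 0 <= len%:R * eta by apply: mulr_ge0.
have [rew rdisc reps rL ru] := hset.
set c1 := len%:R * _ in hw; set c2 := I%:R * _ in hw; set c3 := len%:R * (W + 100) in hw.
pose p1 := p + I%:R * (len%:R * eta).
have p1_ge0 : 0 <= p1 by apply: addr_ge0 => //; apply: mulr_ge0.
apply: (@wp_seq _ _ _ _ _ _ _ _ _ (W - 20) (c1 + c2 + c3 + 2 * W)); last by lra.
apply: wp_straight_const; [|by clear; rewrite /=; lia|exact: lexx].
rewrite /=; split; [by []|by safety; apply: a0|exact: a0|].
split; [by []|by safety; apply: a0|exact: a0|].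
split; [by []|by safety; apply: a0|exact: a0|].
set rm1 := update _ 11 _ _.
have sam1 : sampling k1 b1 rm1.
  split; rewrite /rm1 /update /= ?rdisc ?reps ?rL //.
  by rewrite -!expr2 divfK // mulf_neq0 ?lt0r_neq0.
have h1 : coarse_inv p1 0 (im 2%N) rm1 r.
  split; [exact: hset|exact: sam1|].
  case: hr => [|[hr [hc hd hs]]]; [by left|right; split; last by split].
  suff -> : p1 + (len - 0)%:R * eta = p + I.+1%:R * (len%:R * eta) by [].
  by rewrite /p1 subn0 -[in RHS]natr1; ring.
have sz1 : sized S A im := sz.
clearbody rm1; clear sam1 sz hset hr rew rdisc reps rL ru.
apply: (@wp_seq _ _ _ _ _ _ _ _ _ c1 (c2 + c3 + 2 * W - 1)); last by lra.
apply: wp_mono (wp_coarse_pass p1_ge0 sz1 h1 (lexx _)) (lexx _) _.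
move=> {h1 sz1 im rm1 r} im rm1 r [[hset _ hr] sz].
rewrite subnn mul0r addr0 in hr.
have [rew rdisc reps rL ru] := hset.
apply: (@wp_seq _ _ _ _ _ _ _ _ _ (W - 20) (c2 + c3 + W)); last by lra.
apply: wp_straight_const; [|by clear; rewrite /=; lia|exact: lexx].
rewrite /=; split; [by []|by safety; apply: a0|exact: a0|].
split; [by []|by safety; apply: a0|exact: a0|].
split; [by []|by safety; apply: a0|exact: a0|].
split; [by []|by []|exact: a0|].
set rm2 := update _ 14 _ _.
have sam2 : sampling k2 b2 rm2.
  split; rewrite /rm2 /update /= ?rdisc ?ru ?rL //.
  by rewrite divfK // mulf_neq0 ?lt0r_neq0.
have h2 : budget lam p1 (fine_state 0 (im 2%N) (rm2 4%N) (rm2 5%N) (rm2 6%N)) r.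
  case: hr => [|[hr [hc hd hs hw']]]; [by left|right; split=> //].
  rewrite -[rm2 4%N]/(rm1 4%N) -[rm2 5%N]/(rm1 5%N) -[rm2 6%N]/(rm1 6%N).
  split=> // s'.
  - by rewrite hd.
  - by move=> a; apply: hw'; apply: pair_index_lt.
  - by apply: le_trans (sweep_error0 A_gt0 eps_itv u_itv s'); rewrite ffunE hd addr0;
    have [] := hc s'.
have set2 : setting u rm2 := hset.
have r14 : rm2 14%N 0%N = 0 by [].
clearbody rm2; clear hset hr rew rdisc reps rL ru.
apply: (@wp_seq _ _ _ _ _ _ _ _ _ (c2 + 20) (c3 + W - 21)); last by lra.
apply: wp_mono (wp_sweeps p_ge0 sz set2 sam2 r14 hI h2 (lexx _)) (lexx _) _.
move=> {h2 sz sam2 set2 r14 im rm rm1 rm2 r} im rm r [sz hset hr].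
have h3 : merge_inv p 0 (im 2%N) rm r.
  split=> //; case: hr => [|[hr [i hi hst]]]; [by left|right; split=> //].
  have [hc hd hs _ hE] := hst.
  split=> // s'; first by have [h _] := hc s'; split.
  by apply: le_trans (hE s') _; exact: sweep_error_half.
apply: (@wp_seq _ _ _ _ _ _ _ _ _ c3 (W - 22)); last by lra.
apply: wp_mono (wp_merge_pass sz h3 (lexx _)) (lexx _) _.
move=> {h3 sz hset hr im rm r} im rm r [[hset hr] sz].
have [rew rdisc reps rL ru] := hset.
apply: wp_straight; last by apply: (@le_trans _ _ 10); [rewrite ler_nat|lra].
rewrite /=; split; [by []|by safety; apply: a0|exact: a0|].
split; [exact: sz|by split=> //; rewrite /update /= ru|].
case: hr => [|[hr [hnn hs hE hz]]]; [by left|right; split=> //].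
have /card_gt0P[a _] := A_gt0.
have hd (s : S) : rm 5%N (enum_rank s) = 0 by apply: (hz s a); exact: pair_index_lt.
split=> // s'; have [h _] := hnn s'; split=> //.
by have := hE s'; rewrite ffunE hd addr0.
Qed.

End Epoch.
End Passes.

(** Produces a confidence level of logarithmic order without a logarithm. Halving [y] divides
    [y ^+ 2] by 4 while adding 2 to [L], and [4 <= expR 2]; the start [L = 5] provides the factor
    32. So [32 * Y ^+ 2 <= expR L * y ^+ 2] is invariant, where [Y] is the initial [y]. *)
Definition confidence_loop : cmd :=
  While (BRLt (RConst 1) (rvar 15))
    (Seq (rset 15 (RDiv (rvar 15) (RConst 2))) (rset 7 (RAdd (rvar 7) (RConst 2)))).

(** No expression converts an integer cell to a real, so the pairs are counted afresh in a real
    cell. *)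
Definition count_pairs : cmd := foreach_pair (rset 15 (RAdd (rvar 15) (RConst 1))).

Definition setup : cmd :=
  Seq (rset 15 (RConst 0)) (Seq count_pairs
  (Seq (rset 15 (RDiv (rvar 15) (RMul (RMul gap (rvar 3)) (rvar 2))))
  (Seq (rset 7 (RConst 5)) (Seq confidence_loop (rset 8 (RDiv (RConst 1) gap)))))).

Definition epochs : cmd := While (BRLt (rvar 2) (rvar 8)) epoch.

Definition program : cmd := Seq setup epochs.

(** * Number of epochs, total failure probability and total time *)

Section Main.
Context (R : realType) (S A : finType) (M : dmdp R S A) (tau : nat).
Hypothesis S_gt0 : (0 < #|S|)%N.
Hypothesis A_gt0 : (0 < #|A|)%N.
Variables (eps delta lam : R).
Hypothesis eps_itv : 0 < eps < 1.
Hypothesis delta_itv : 0 < delta < 1.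
Hypothesis lam_ge0 : 0 <= lam.

Let len := (#|S| * #|A|)%N.
Let wp := wp M 16 len tau.
Let W : R := (100 + tau)%:R.
Let V := optimal_value M.
Let g := 1 - discount M.
Let H := g^-1.
Let Y := len%:R / (g * delta * eps).
Let W_ge100 : 100 <= W. Proof. by rewrite /W ler_nat leq_addr. Qed.
Let g_itv : 0 < g < 1. Proof. exact: gap_itv. Qed.
Let len_ge1 : 1 <= len%:R :> R. Proof. by rewrite ler1n muln_gt0 S_gt0. Qed.
Let Y_gt0 : 0 < Y.
Proof.
case/andP: g_itv => g0 _; case/andP: eps_itv => e0 _; case/andP: delta_itv => d0 _.
by rewrite divr_gt0 ?mulr_gt0 // (lt_le_trans ltr01).
Qed.

Lemma wp_setup (n : nat) im rm r w : sized S A im ->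
  rm 1%N 0%N = discount M -> rm 2%N 0%N = eps -> rm 3%N 0%N = delta ->
  Y <= 2 ^+ n -> len%:R * 106 + n%:R * 20 + 100 <= w ->
  wp setup w (fun im' rm' r' => [/\ sized S A im' /\ im' 2%N = im 2%N, r' = r,
    forall i, i != 7%N -> i != 8%N -> i != 15%N -> rm' i = rm i, rm' 8%N 0%N = H &
    [/\ 5 <= rm' 7%N 0%N, rm' 7%N 0%N <= 5 + n%:R * 2 & 32 * Y ^+ 2 <= expR (rm' 7%N 0%N)]])
    im rm r.
Proof.
move=> sz r1 r2 r3 hY hw; have W0 := W_ge100.
have a0 := fun x => @allocated0 S A S_gt0 A_gt0 x.
have n0 := ler0n R n; have l1 := len_ge1.
set w1 := len%:R * 106 in hw.
apply: (@wp_seq _ _ _ _ _ _ _ _ _ 3 (w - 4)); last by lra.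
apply: wp_straight; last by rewrite ler_nat.
split; [by []|by []|exact: a0|].
pose frame rm' := forall i, i != 7%N -> i != 8%N -> i != 15%N -> rm' i = rm i :> (nat -> R).
pose J m (pol : nat -> nat) rm' r' := [/\
  pol = im 2%N, r' = r, frame rm' & rm' 15%N 0%N = m%:R :> R].
apply: (@wp_seq _ _ _ _ _ _ _ _ _ w1 (w - 5 - w1)); last by lra.
have J0 : J 0%N (im 2%N) (update rm 15 0 0) r.
  split=> // i _ _ i15; apply/funext => l; by rewrite /update (negPf i15).
have wb0 : 0 <= 6 :> R by [].
apply: wp_mono (wp_foreach_pair S_gt0 A_gt0 wb0 _ sz J0) _ _.
- move=> s a {J0} im1 rm1 r' sz1 i3 i4 i5 [hp hr fr h15].
  apply: wp_straight; last by rewrite ler_nat.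
  split; [by []|by rewrite /=; safety; apply: a0|exact: a0|].
  split=> //; split=> //=; last by rewrite /update /= h15 natr1.
  move=> i i7 i8 i15; apply/funext => l; rewrite /update (negPf i15) /=.
  by rewrite fr.
- by rewrite /w1 ler_wpM2l // -natrD ler_nat.
move=> im1 rm1 r' [[hp -> fr h15] sz1] {r' J0 J}.
have r1' : rm1 1%N 0%N = discount M by rewrite fr.
have r2' : rm1 2%N 0%N = eps by rewrite fr.
have r3' : rm1 3%N 0%N = delta by rewrite fr.
apply: (@wp_seq _ _ _ _ _ _ _ _ _ 20 (w - 30 - w1)); last by lra.
apply: wp_straight; last by rewrite ler_nat.
split; [by []|by rewrite /=; safety; apply: a0|exact: a0|].
set rm2 := update _ 15 _ _.
have h15' : rm2 15%N 0%N = Y by rewrite /rm2 /update /= h15 r1' r2' r3'.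
have fr2 : frame rm2.
  by move=> i i7 i8 i15; apply/funext => l; rewrite /rm2 /update (negPf i15) /= fr.
clearbody rm2; apply: (@wp_seq _ _ _ _ _ _ _ _ _ 3 (w - 35 - w1)); last by lra.
apply: wp_straight; last by rewrite ler_nat.
split; [by []|by []|exact: a0|].
set rm3 := update _ 7 _ _.
have h7 : rm3 7%N 0%N = 5 by [].
have h15'' : rm3 15%N 0%N = Y by [].
have fr3 : frame rm3.
  by move=> i i7 i8 i15; apply/funext => l; rewrite /rm3 /update (negPf i7) /= fr2.
clearbody rm3; clear rm2 h15' fr2 rm1 fr h15 r1' r2' r3'.
pose I m : assertion R := fun im' rm' r' => [/\ sized S A im' /\
  im' 2%N = im 2%N, r' = r, frame rm' &
  exists y L : R, [/\ rm' 15%N 0%N = y /\ rm' 7%N 0%N = L, 0 < y, y <= 2 ^+ m,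
    5 <= L /\ L + m%:R * 2 <= 5 + n%:R * 2 & 32 * Y ^+ 2 <= expR L * y ^+ 2]].
apply: (@wp_seq _ _ _ _ _ _ _ _ _ (n%:R * 20 + 10) (w - 50 - w1 - n%:R * 20)); last by lra.
apply: (@wp_while _ _ _ _ _ _ _ I _ _ 13 _ _ _ n) => //.
- move=> m {im1 hp sz1 rm3 h7 h15'' fr3} im1 rm1 r' [[sz1 hp] hr fr [y [L [[ry rL] y0 ym
  [L5 Ln] hL]]]].
  split; first by rewrite /=; safety; apply: a0.
  rewrite /= ry; case: ltrP => hy; last first.
    apply: wp_straight; last by apply: (@le_trans _ _ 10); [rewrite ler_nat|lra].
    split; [by []|by rewrite /=; safety; apply: a0|exact: a0|].
    split; [by []|by []| | |].
    + by move=> i i7 i8 i15; apply/funext => l; rewrite /update (negPf i8) /= fr.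
    + by rewrite /update /= fr // r1 div1r.
    rewrite /update /= rL; split=> //.
      by have := ler0n R m; lra.
    apply: le_trans hL _; rewrite ler_piMr ?expR_ge0 // expr_le1 //.
    exact: ltW.
  have m_gt0 : (0 < m)%N.
    by rewrite lt0n; apply/eqP => m0; move: ym; rewrite m0 expr0 leNgt hy.
  split; first exact: m_gt0.
  apply: wp_straight; last by rewrite ler_nat.
  split; [by []|by rewrite /=; safety; apply: a0|exact: a0|].
  split; [by []|by rewrite /=; safety; apply: a0|exact: a0|].
  split; [by []|by []| |].
    by move=> i i7 i8 i15; apply/funext => l;
      rewrite /update (negPf i7) /= (negPf i15) /= fr.
  exists (y / 2), (L + 2); rewrite /update /= ry rL; split=> //.
  + by rewrite divr_gt0.
  + by rewrite ler_pdivrMr // -exprSr prednK.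
  + by split; [lra|move: Ln; rewrite -[in X in X -> _](prednK m_gt0) -natr1; lra].
  apply: le_trans hL _; rewrite expRD.
  have e1 : 2 <= expR 1 :> R := expR1_ge2 R.
  have -> : expR 2 = expR 1 ^+ 2 :> R by rewrite -expRM_natr mul1r.
  have e4 : 2 ^+ 2 <= expR 1 ^+ 2 :> R by rewrite lerXn2r ?nnegrE ?expR_ge0.
  have -> : expR L * expR 1 ^+ 2 * (y / 2) ^+ 2 = (expR L * y ^+ 2) * (expR 1 ^+ 2 / 4)
    by field.
  by apply: ler_peMr; [apply: mulr_ge0 (expR_ge0 _) (sqr_ge0 _)|lra].
- split=> //; exists Y, 5; split=> //.
  rewrite ler_wpM2r ?sqr_ge0 //.
  have -> : expR 5 = expR 1 ^+ 5 :> R by rewrite -expRM_natr mul1r.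
  have -> : 32 = 2 ^+ 5 :> R by ring.
  by rewrite lerXn2r ?nnegrE ?expR_ge0 // expR1_ge2.
- by rewrite /=; lra.
Qed.

Let eta (L : R) := 2 * expR (- L).

Let g_inv_ge1 : 1 <= H.
Proof. by case/andP: g_itv => g0 g1; rewrite /H -invr1 lef_pV2 ?posrE // ltW. Qed.

Let eps_inv_ge1 : 1 <= eps^-1.
Proof. by case/andP: eps_itv => e0 e1; rewrite -invr1 lef_pV2 ?posrE // ltW. Qed.

Let unit_cost : R := H ^+ 3 * eps^-1 ^+ 2.

Let unit_cost_ge : H ^+ 3 <= unit_cost.
Proof. by rewrite ler_peMr ?exprn_ge0 ?exprn_ege1 // (le_trans ler01). Qed.

Let H_le_cube : H <= H ^+ 3.
Proof. by rewrite exprS ler_peMr ?exprn_ege1 // (le_trans ler01). Qed.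

(** A fine estimate takes [8 * 64 * 64 * (L * H ^+ 2)] samples whatever [u] is. Up to [4 * H] sweeps
    thus cost of order [L * H ^+ 3] per pair, which the coarse cost [L * unit_cost] dominates as
    [eps < 1]. *)
Lemma epoch_cost (u L : R) (I : nat) : 5 <= L -> eps < u -> I%:R <= 4 * H ->
  len%:R * ((8 * L / (coarse_scale M eps * coarse_margin M eps) + 3) * W + 100)
  + I%:R * (len%:R * ((8 * L / (fine_scale M u * fine_margin M u) + 3) * W + 100) + 30)
  + len%:R * (W + 100) + 3 * W
  <= 400 * (1000 * (len%:R * (W * (L * unit_cost)))).
Proof.
move=> hL hu hI; have W0 := W_ge100; have l1 := len_ge1.
have /andP[g0 g1] := g_itv; have /andP[e0 e1] := eps_itv.
have u0 : 0 < u by lra.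
have E1 : 8 * L / (coarse_scale M eps * coarse_margin M eps) =
    8 * 128 * 64 * (L * unit_cost).
  rewrite /coarse_scale /coarse_margin -/g /unit_cost /H; field.
  by rewrite !lt0r_neq0.
have E2 : 8 * L / (fine_scale M u * fine_margin M u) = 8 * 64 * 64 * (L * H ^+ 2).
  rewrite /fine_scale /fine_margin -/g /H; field.
  by rewrite !lt0r_neq0.
rewrite E1 E2.
set X := L * unit_cost.
have H1 := g_inv_ge1.
have X_ge : 5 * H <= X.
  by apply: ler_pM => //; [lra|apply: le_trans unit_cost_ge].
have LH2 : H * (L * H ^+ 2) <= X.
  rewrite mulrCA; apply: ler_wpM2l; first lra.
  exact: le_trans unit_cost_ge.
have h1 : len%:R * ((8 * 128 * 64 * X + 3) * W + 100) <= len%:R * (W * (8 * 128 * 64 * X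
  + 4)).
  by apply: ler_wpM2l; lra.
have h2 : I%:R * (len%:R * ((8 * 64 * 64 * (L * H ^+ 2) + 3) * W + 100) + 30)
    <= len%:R * (W * (8 * 64 * 64 * 4 * X + 5 * X)).
  have LH0 : 0 <= L * H ^+ 2 by apply: mulr_ge0 (sqr_ge0 _); lra.
  apply: (@le_trans _ _ (4 * H * (len%:R * (W * (8 * 64 * 64 * (L * H ^+ 2) + 5))))).
    have b1 : len%:R * ((8 * 64 * 64 * (L * H ^+ 2) + 3) * W + 100) + 30 <= len%:R * (W *
      (8 * 64 * 64 * (L * H ^+ 2) + 5)).
      have : len%:R * 100 <= len%:R * W by apply: ler_wpM2l; lra.
      by lra.
    apply: ler_pM => //.
    apply: addr_ge0 => //; apply: mulr_ge0; first lra.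
    by apply: addr_ge0 => //; apply: mulr_ge0; lra.
  rewrite mulrCA; apply: ler_wpM2l; first lra.
  rewrite mulrCA; apply: ler_wpM2l; first lra.
  lra.
have h3 : len%:R * (W + 100) + 3 * W <= len%:R * (W * 5).
  have : len%:R * 100 <= len%:R * W by apply: ler_wpM2l; lra.
  have : 1 * W <= len%:R * W by apply: ler_wpM2r; lra.
  by lra.
apply: (@le_trans _ _ (len%:R * (W * (8 * 128 * 64 * X + 4 + (8 * 64 * 64 * 4 * X + 5 *
  X) + 5)))); first lra.
have -> : 400 * (1000 * (len%:R * (W * X))) = len%:R * (W * (400 * 1000 * X)) by ring.
apply: ler_wpM2l; first lra.
apply: ler_wpM2l; first lra.
by lra.
Qed.

Lemma wp_epochs (L : R) (K I : nat) im rm r w : 5 <= L ->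
  3 / g <= I%:R -> I%:R <= 4 * H -> H <= 2 ^+ K * eps ->
  epoch_inv M eps lam L H (K%:R * (I.+1%:R * (len%:R * eta L))) im rm r ->
  K%:R * (400 * (1000 * (len%:R * (W * (L * unit_cost)))) + 10) + 10 <= w ->
  wp epochs w (fun im rm r => exists2 u, u <= eps & epoch_inv M eps lam L u 0 im rm r) im
    rm r.
Proof.
move=> hL hI hI' hK h0 hw; have W0 := W_ge100; have l1 := len_ge1.
have a0 := fun x => @allocated0 S A S_gt0 A_gt0 x.
have L0 : 0 < L by lra.
set c := 400 * _ in hw.
have c0 : 0 <= c.
  by do 5!apply: mulr_ge0 => //; try lra; apply: le_trans unit_cost_ge; apply: exprn_ge0;
    apply: le_trans g_inv_ge1.
have le_eta : 0 <= I.+1%:R * (len%:R * eta L) by apply: mulr_ge0 => //;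
  apply: mulr_ge0 => //; apply: mulr_ge0 => //; apply: expR_ge0.
pose J n : assertion R := fun im rm r => exists u, [/\ u <= H, u <= 2 ^+ n * eps &
  epoch_inv M eps lam L u (n%:R * (I.+1%:R * (len%:R * eta L))) im rm r].
apply: (@wp_while _ _ _ _ _ _ _ J _ _ c _ _ _ K) => //.
- move=> n {h0 im rm r} im rm r [u [uH un hu]].
  split; first by rewrite /=; safety; apply: a0.
  have [_ [_ _ reps _ ru] _] := hu.
  rewrite /= reps ru; case: ltrP => hlt; last first.
    exists u => //; have [h1 h2 hr] := hu; split=> //.
    case: hr => [|[hr hst]]; [by left|right; split=> //].
    by apply: le_trans hr; rewrite ler_wpM2l // mulr_ge0.
  have n_gt0 : (0 < n)%N.
    by rewrite lt0n; apply/eqP => n0; move: un; rewrite n0 expr0 mul1r leNgt hlt.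
  split; first exact: n_gt0.
  have u_itv : eps < u <= (1 - discount M)^-1 by rewrite hlt.
  pose p := n.-1%:R * (I.+1%:R * (len%:R * eta L)).
  have p_ge0 : 0 <= p by apply: mulr_ge0.
  have hu' : epoch_inv M eps lam L u (p + I.+1%:R * (len%:R * eta L)) im rm r.
    suff -> : p + I.+1%:R * (len%:R * eta L) = n%:R * (I.+1%:R * (len%:R * eta L)) by [].
    by rewrite /p -[in RHS](prednK n_gt0) -[in RHS]natr1; ring.
  apply: wp_mono (wp_epoch (tau :=
    tau) S_gt0 A_gt0 eps_itv lam_ge0 L0 u_itv p_ge0 hI hu' (lexx _)) _ _.
    exact: epoch_cost.
  move=> im1 rm1 r1 h1; exists (u / 2); split=> //.
    by have /andP[e0 _] := eps_itv; lra.
  move: un; rewrite -[in X in X -> _](prednK n_gt0) exprS ler_pdivrMr // [2 * _]mulrC.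
  by rewrite mulrAC.
- by exists H; split.
- by rewrite /=; have := ler0n R K; lra.
Qed.

Lemma epoch_outcome (L u : R) im rm r : u <= eps -> epoch_inv M eps lam L u 0 im rm r ->
  lam <= r \/ 0 <= r /\ exists pi : S -> A,
    (forall s, im 2%N (enum_rank s) = enum_rank (pi s)) /\
    forall s, V s - eps <= policy_value M pi s <= V s.
Proof.
move=> hu [_ _ [|[hr [hc hd [pi hpi hv]]]]]; [by left|right]; rewrite mulr0 in hr.
split=> //; exists pi; split=> // s.
have /andP[h1 ->] := policy_value_between A_gt0 hv s; rewrite andbT.
apply: le_trans h1; rewrite ffunE hd addr0.
by have [_] := hc s; rewrite -/V; lra.
Qed.

(** A union bound over [K * I.+1 * len] estimates. The crude [K <= 2 * (H / eps)] suffices, since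
    the count enters [L] only through its logarithm; the square of [Y] covers the product of the
    numbers of epochs and of sweeps. *)
Lemma failure_budget (L : R) (K I : nat) : 32 * Y ^+ 2 <= expR L -> I%:R <= 4 * H ->
  K = 0%N \/ 2 ^+ K.-1 <= H / eps ->
  K%:R * (I.+1%:R * (len%:R * eta L)) <= delta.
Proof.
move=> hL hI hK; have l1 := len_ge1; have H1 := g_inv_ge1; have y0 := Y_gt0.
have /andP[e0 e1] := eps_itv; have /andP[d0 d1] := delta_itv; have /andP[g0 g1] := g_itv.
have hHe : 1 <= H / eps.
  by apply: le_trans H1 _; rewrite ler_peMr ?eps_inv_ge1 // (le_trans ler01).
have K_le : K%:R <= 2 * (H / eps).
  case: hK => [->|]; first by lra.
  case: K => [_|n] /=; first by lra.
  by have := natr_le_pow2 R n; rewrite -[n.+1%:R]natr1; lra.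
have I_le : I.+1%:R <= 5 * H by rewrite -natr1; lra.
have YE : Y = len%:R * (H / eps) / delta.
  by rewrite /Y /H; field; rewrite !lt0r_neq0.
have hx : K%:R * (I.+1%:R * len%:R) <= 10 * (H / eps) ^+ 2 * len%:R.
  rewrite mulrA; apply: ler_wpM2r; first lra.
  apply: (@le_trans _ _ (2 * (H / eps) * (5 * H))); first exact: ler_pM.
  have : H / eps * H <= H / eps * (H / eps).
    apply: ler_wpM2l; first lra.
    by rewrite ler_peMr ?eps_inv_ge1 // (le_trans ler01).
  by lra.
have hy : 32 * ((H / eps) ^+ 2 * len%:R) <= delta * expR L.
  apply: (@le_trans _ _ (delta * (32 * Y ^+ 2))); last by apply: ler_wpM2l hL; exact: ltW.
  have -> : delta * (32 * Y ^+ 2) = 32 * ((H / eps) ^+ 2 * (len%:R * len%:R / delta)).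
    by rewrite YE; field; rewrite !lt0r_neq0.
  apply: ler_wpM2l => //; apply: ler_wpM2l; first exact: sqr_ge0.
  rewrite -mulrA ler_peMr //.
  by rewrite ler_pdivlMr // mul1r; lra.
have Epos := expR_gt0 L.
have -> : K%:R * (I.+1%:R * (len%:R * eta L)) = 2 * (K%:R * (I.+1%:R * len%:R)) / expR L.
  by rewrite /eta expRN; ring.
rewrite ler_pdivrMr //; move: hx hy.
have : 0 <= (H / eps) ^+ 2 * len%:R by apply: mulr_ge0 => //; exact: sqr_ge0.
by lra.
Qed.

Lemma wp_program :
  wp program (14 * (1000 * (1000 * W)) * time_bound M eps delta)
    (fun im rm r => lam <= r \/ 0 <= r /\ exists pi : S -> A,
      (forall s, im 2%N (enum_rank s) = enum_rank (pi s)) /\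
      forall s, V s - eps <= policy_value M pi s <= V s)
    (imem (initial M eps delta program)) (rmem (initial M eps delta program)) (lam * delta).
Proof.
have W0 := W_ge100; have l1 := len_ge1; have H1 := g_inv_ge1; have y0 := Y_gt0.
have /andP[e0 e1] := eps_itv; have /andP[g0 g1] := g_itv.
have [KY [hY hKY]] := pow2_bracket Y.
have mY := pow2_bracket_ln y0 hKY.
have He0 : 0 < H / eps by rewrite divr_gt0 //; lra.
have [K [hK hK']] := pow2_bracket (H / eps).
have mK := pow2_bracket_ln He0 hK'.
pose I := (Num.truncn (3 * H)).+1.
have hI : 3 / g <= I%:R by rewrite -/H ltW // truncnS_gt.
have hI' : I%:R <= 4 * H.
  have H3 : 0 <= 3 * H by lra.
  by rewrite /I -natr1; have /andP[] := truncn_itv H3; lra.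
set im0 := imem _; set rm0 := rmem _.
have sz : sized S A im0 by [].
set m1 := Num.max 1 (ln Y) in mY.
set m2 := Num.max 1 (ln (H / eps)) in mK.
have m1_ge1 : 1 <= m1 by rewrite le_max lexx.
have m2_ge1 : 1 <= m2 by rewrite le_max lexx.
set w := _ * time_bound M eps delta.
pose ws : R := len%:R * 106 + KY%:R * 20 + 100.
have wE : w = 14 * (1000 * (1000 * W)) * (len%:R * unit_cost * m1 * m2).
  rewrite /w /time_bound -/g -/len -/Y -/m1; congr (_ * (_ * _ * _)).
    by rewrite /unit_cost /H; field; rewrite !lt0r_neq0.
  by rewrite /m2 /H; congr (Num.max 1 (ln _)); rewrite div1r invfM.
apply: (@wp_seq _ _ _ _ _ _ _ _ _ ws (w - ws - 1)); last by lra.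
have hs := wp_setup (r := lam * delta) sz _ _ _ hY (lexx ws).
apply: wp_mono (hs rm0 _ _ _) (lexx _) _ => // {hs}.
move=> im rm _ [[sz1 hp] -> fr r8 [L5 Lle hL]].
set L := rm 7%N 0%N in L5 Lle hL.
have pairE (s : S) (a : A) : (pair_index s a %/ #|A| = enum_rank s)%N /\
  (pair_index s a %% #|A| = enum_rank a)%N.
  have div_mod x y n : (y < n)%N -> ((x * n + y) %/ n = x /\ (x * n + y) %% n = y)%N.
    by move=> yn; rewrite divnMDl ?(leq_trans _ yn) // divn_small // addn0 modnMDl
      modn_small.
  by rewrite /pair_index; apply: div_mod (ltn_ord (enum_rank a)).
have h0 : epoch_inv M eps lam L H (K%:R * (I.+1%:R * (len%:R * eta L))) im rm (lam * delta).
  split; [exact: sz1| |right; split].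
  - split; [move=> s a|by rewrite fr|by rewrite fr|by []|exact: r8].
    have [h1 h2] := pairE s a; rewrite fr //.
    transitivity (if (decode S (pair_index s a %/ #|A|), decode A (pair_index s a %%
      #|A|))%N
      is (Some s', Some a') then reward M s' a' else 0); first by [].
    by rewrite h1 h2 !decode_rank.
  - by apply: ler_wpM2l => //; apply: failure_budget.
  have r4 : rm 4%N = fun=> 0 by rewrite fr.
  have r5 : rm 5%N = fun=> 0 by rewrite fr.
  rewrite r4 r5 hp; split=> // [s|].
    by split=> //; rewrite subr0; have /andP[] := optimal_value_itv M A_gt0 s.
  (* The zeroed memory encodes the constant policy whose action has index 0. The value 0 is below
     its backup because rewards are nonnegative. *)
  have [a Ea] := rank_onto A_gt0; exists (fun=> a) => s.
    by rewrite -Ea /im0 /=; case: ifP.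
  have /andP[] : 0 <= backup M (value S (fun=> 0) (fun=> 0)) s a <= H.
    by apply: backup_itv => t; rewrite ffunE addr0 lexx (le_trans ler01).
  by rewrite [value _ _ _ s]ffunE addr0.
apply: wp_mono (wp_epochs L5 hI hI' _ h0 (lexx _)) _ _.
- by rewrite -ler_pdivrMr.
- have UC : 1 <= unit_cost.
    by apply: le_trans unit_cost_ge; apply: exprn_ege1.
  have ge0 (x : R) : 1 <= x -> 0 <= x by move=> ?; lra.
  have prod_ge1 (x y : R) : 1 <= x -> 1 <= y -> 1 <= x * y by move=> x1 y1;
    rewrite mulr_ege1.
  pose Q := len%:R * unit_cost * m1 * m2.
  have factor_le (x y : R) : 1 <= x -> 1 <= y -> Q = x * y -> x <= Q.
    by move=> x1 y1 ->; rewrite ler_peMr ?ge0.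
  have lQ : len%:R <= Q.
    apply: (factor_le _ (unit_cost * m1 * m2) l1 (prod_ge1 _ _ (prod_ge1 _ _ UC m1_ge1)
      m2_ge1)).
    by rewrite /Q; ring.
  have m1Q : m1 <= Q.
    apply: (factor_le _ (len%:R * unit_cost * m2) m1_ge1 (prod_ge1 _ _ (prod_ge1 _ _ l1
      UC) m2_ge1)).
    by rewrite /Q; ring.
  have m2Q : m2 <= Q.
    apply: (factor_le _ (len%:R * unit_cost * m1) m2_ge1 (prod_ge1 _ _ (prod_ge1 _ _ l1
      UC) m1_ge1)).
    by rewrite /Q; ring.
  have WQ : 100 * Q <= W * Q by apply: ler_wpM2r => //; lra.
  (* [L <= 5 + 2 * KY] and [KY <= 3 * m1] give [11 = 5 + 2 * 3]. With [K <= 3 * m2], the product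
     [33 * 400 * 1000] leaves room for the setup below [14 * 1000 * 1000]. *)
  have LUC : L * unit_cost <= 11 * m1 * unit_cost by apply: ler_wpM2r; lra.
  have step1 : K%:R * (len%:R * (W * (L * unit_cost))) <= 3 * m2 * (len%:R * (W * (11 *
    m1 * unit_cost))).
    apply: ler_pM => //.
      by apply: mulr_ge0 => //; apply: mulr_ge0; [lra|apply: mulr_ge0; lra].
    apply: ler_wpM2l; first lra.
    by apply: ler_wpM2l; lra.
  have step2 : 3 * m2 * (len%:R * (W * (11 * m1 * unit_cost))) = 33 * (W * Q) by rewrite
    /Q; ring.
  rewrite step2 in step1.
  rewrite wE -/Q /ws.
  by lra.
- by move=> im1 rm1 r1 [u hu h1]; apply: epoch_outcome hu h1.
Qed.

End Main.

Theorem theorem5p5 (R : realType) (tau : nat) :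
  exists (prog : cmd) (narr : nat) (C : R),
  forall (S A : finType), (0 < #|S|)%N -> (0 < #|A|)%N ->
  forall (M : dmdp R S A) (eps delta : R), 0 < eps < 1 -> 0 < delta < 1 ->
  let T := C * time_bound M eps delta in
  exists len steps : nat,
    [/\ (words narr len)%:R <= C * (#|S| * #|A|)%:R,
        Pr narr len M tau steps
          (fun c => [/\ halted c, (clock c)%:R <= T & (queries c)%:R <= T])
          (initial M eps delta prog) = 1
      & 1 - delta <=
        Pr narr len M tau steps
          (fun c => exists pi : S -> A,
             outputs narr len c pi /\
             forall s : S, optimal_value M s - eps <= policy_value M pi s
                           <= optimal_value M s)
          (initial M eps delta prog)].
Proof.
(* The constant depends on [tau] only; it also bounds the 32 words used per pair. *)
exists program, 16%N, (14 * (1000 * (1000 * (100 + tau)%:R))).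
move=> S A S_gt0 A_gt0 M eps delta eps_itv delta_itv T.
set len := (#|S| * #|A|)%N; exists len.
have d0 : 0 <= delta by case/andP: delta_itv => /ltW.
(* A failure costs [b]: 1 for the correctness, and 0 for the running time, which
   is thus bounded almost surely. *)
have run (b : bool) (E : config R -> Prop) :
    (forall (im : nat -> nat -> nat) (rm : nat -> nat -> R) t q, t%:R <= T -> (q <= t)%N ->
       (b -> exists pi : S -> A, (forall s, im 2%N (enum_rank s) = enum_rank (pi s)) /\
         forall s, optimal_value M s - eps <= policy_value M pi s <= optimal_value M s) ->
       E (Config [::] im rm t q)) ->
    good M 16 len tau (fun c => (~~ `[< E c >])%:R) (initial M eps delta program) (b%:R *
      delta).
  move=> hE; apply: (wp_program (tau := tau) S_gt0 A_gt0 eps_itv delta_itv (ler0n R b)).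
  move=> im rm t q r hr; rewrite add0r -/T => ht hq.
  have qt : (q <= t)%N by move: hq; rewrite addn0 add0n.
  apply: good_halt => //.
  case: asboolP => [_|nE] /=; first by case: hr => [|[]] //; apply: le_trans.
  case: b hE hr => hE [//|[r0 hpi]]; by case: nE; apply: hE.
set Etime := fun c => [/\ halted c, _ & _].
set Epol := fun c => exists pi, _.
have [n1 h1] : good M 16 len tau (fun c =>
  (~~ `[< Etime c >])%:R) (initial M eps delta program) (false%:R * delta).
  apply: run => im rm t q ht qt _.
  by split=> //; apply: le_trans ht; rewrite ler_nat.
have [n2 h2] : good M 16 len tau (fun c =>
  (~~ `[< Epol c >])%:R) (initial M eps delta program) (true%:R * delta).
  apply: run => im rm t q _ _ /(_ isT)[pi [hpi hv]].
  exists pi; split=> //; split=> // s.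
  rewrite /= (_ : allocated _ _ _ _ = true) ?hpi //.
  by rewrite /allocated /=; apply: leq_trans (ltn_ord _) _; rewrite leq_pmulr.
exists (maxn n1 n2); split.
- rewrite /words -/len natrD natrM.
  have : 0 <= (100 + tau)%:R * len%:R :> R by rewrite mulr_ge0.
  have : 100 * len%:R <= (100 + tau)%:R * len%:R :> R.
    by rewrite ler_wpM2r // ler_nat leq_addr.
  by lra.
- have := h1 _ (leq_maxl n1 n2); rewrite mul0r => h.
  rewrite PrE (_ : expected _ _ _ _ _ _ _ = 0) ?subr0 //.
  by apply/le_anti; rewrite h expected_ge0.
- have := h2 _ (leq_maxr n1 n2); rewrite mul1r PrE => h.
  by rewrite lerD2l lerN2.
Qed.
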